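(* Let $X$ be a $G$-invariant closed subset of $\mathbb{R}^n$. Then $X\cap\mathrm{Crit}_G(\mathbb{R}^n)$ is a $K$-equivariant strong deformation retract of $X$.
   Context: Let $G$ be a real algebraic subgroup of $GL(n,\mathbb{R})$ invariant under transpose $g\mapsto g^{*}$, with Lie algebra $\mathfrak g$, and let $K=G\cap O(n)$. A vector $v\in\mathbb{R}^n$ is critical if $\langle Xv,v\rangle=0$ for all $X\in\mathfrak g$; $\mathrm{Crit}_G(\mathbb{R}^n)$ is the set of critical vectors. A strong deformation retraction of $X$ onto a closed subset $W$ is a continuous $U:[0,1]\times X\to X$ with $U(0,x)=x$, $U(t,w)=w$ for $w\in W$, $t\in[0,1]$, and $U(1,X)=W$; it is $K$-equivariant if $U(t,kx)=kU(t,x)$. *)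

(* Defs.v *)
From Stdlib Require Import Reals.
From mathcomp Require Import all_boot.

Set Implicit Arguments.
Unset Strict Implicit.
Unset Printing Implicit Defensive.

Local Open Scope R_scope.

Definition vec (n : nat) := 'I_n -> R.
Definition mat (n : nat) := 'I_n -> 'I_n -> R.

Definition rsum (n : nat) (F : 'I_n -> R) : R := \big[Rplus/R0]_(i < n) F i.

Definition mmul {n} (A B : mat n) : mat n :=
  fun i j => rsum (fun k => A i k * B k j).
Definition mid {n} : mat n := fun i j => if i == j then R1 else R0.
Definition mtr {n} (A : mat n) : mat n := fun i j => A j i.
Definition mscale {n} (t : R) (A : mat n) : mat n := fun i j => t * A i j.
Definition mvec {n} (A : mat n) (v : vec n) : vec n :=
  fun i => rsum (fun k => A i k * v k).
Definition dot {n} (u v : vec n) : R := rsum (fun i => u i * v i).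
Definition edist {n} (u v : vec n) : R := sqrt (rsum (fun i => (u i - v i) * (u i - v i))).

Fixpoint mpow {n} (A : mat n) (k : nat) : mat n :=
  match k with O => mid | S k' => mmul A (mpow A k') end.

Definition is_mexp {n} (A E : mat n) : Prop :=
  forall i j, Un_cv (fun N => sum_f_R0 (fun k => mpow A k i j / INR (Stdlib.Arith.Factorial.fact k)) N) (E i j).

Inductive mpoly (n : nat) : Type :=
| PVar : 'I_n -> 'I_n -> mpoly n
| PConst : R -> mpoly n
| PAdd : mpoly n -> mpoly n -> mpoly n
| PMul : mpoly n -> mpoly n -> mpoly n.

Fixpoint peval {n} (p : mpoly n) (g : mat n) : R :=
  match p with
  | PVar i j => g i j
  | PConst c => c
  | PAdd p q => peval p g + peval q g
  | PMul p q => peval p g * peval q g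
  end.

Definition invertible {n} (g : mat n) : Prop :=
  exists h : mat n, mmul g h = mid /\ mmul h g = mid.

Definition real_algebraic_subgroup {n} (G : mat n -> Prop) : Prop :=
  (exists S : mpoly n -> Prop,
      forall g, G g <-> (invertible g /\ forall p, S p -> peval p g = 0)) /\
  G mid /\
  (forall g h, G g -> G h -> G (mmul g h)) /\
  (forall g, G g -> exists h, G h /\ mmul g h = mid /\ mmul h g = mid).

Definition transpose_invariant {n} (G : mat n -> Prop) : Prop :=
  forall g, G g -> G (mtr g).

Definition lie_alg {n} (G : mat n -> Prop) (X : mat n) : Prop :=
  forall t : R, exists E, is_mexp (mscale t X) E /\ G E.

Definition orthogonal {n} (g : mat n) : Prop := mmul (mtr g) g = mid.

Definition maxcpt {n} (G : mat n -> Prop) (k : mat n) : Prop := G k /\ orthogonal k.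

Definition critical {n} (G : mat n -> Prop) (v : vec n) : Prop :=
  forall X, lie_alg G X -> dot (mvec X v) v = 0.

Definition closed_subset {n} (X : vec n -> Prop) : Prop :=
  forall x, (forall eps, eps > 0 -> exists y, X y /\ edist x y < eps) -> X x.

Definition G_invariant {n} (G : mat n -> Prop) (X : vec n -> Prop) : Prop :=
  forall g x, G g -> X x -> X (mvec g x).

Definition unit_interval (t : R) : Prop := 0 <= t <= 1.

Definition continuous_on_IX {n} (X : vec n -> Prop) (U : R -> vec n -> vec n) : Prop :=
  forall t x, unit_interval t -> X x ->
    forall eps, eps > 0 -> exists delta, delta > 0 /\
      forall t' x', unit_interval t' -> X x' ->
        Rabs (t - t') < delta -> edist x x' < delta -> edist (U t x) (U t' x') < eps.

Definition strong_deformation_retraction {n} (X W : vec n -> Prop)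
    (U : R -> vec n -> vec n) : Prop :=
  continuous_on_IX X U /\
  (forall t x, unit_interval t -> X x -> X (U t x)) /\
  (forall x, X x -> U 0 x = x) /\
  (forall t w, unit_interval t -> W w -> U t w = w) /\
  (forall x, X x -> W (U 1 x)) /\
  (forall w, W w -> exists x, X x /\ U 1 x = w).

Definition K_equivariant {n} (G : mat n -> Prop) (X : vec n -> Prop)
    (U : R -> vec n -> vec n) : Prop :=
  forall t k x, unit_interval t -> maxcpt G k -> X x ->
    U t (mvec k x) = mvec k (U t x).

(* Main.v *)
From Stdlib Require Import Reals.
From HB Require Import structures.
From mathcomp Require Import all_boot all_order all_algebra.
From mathcomp Require Import Rstruct all_classical all_reals all_analysis.
From mathcomp Require Import ring lra.
Require Import Defs.

(* The moment map [F x] is the symmetric element of the Lie algebra with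
   [<F x, B> = <B x, x>] for all symmetric [B] in the Lie algebra; [x] is critical iff
   [F x = 0]. The retraction composes infinitely many moves [x |-> exp (- s F x) x], which
   stay in the [G]-orbit and commute with [K]. Convergence does not come from a Lojasiewicz
   inequality but from the global bound [|x|^2 - |g x|^2 <= C |F x|] for all [g] in [G]: by the
   Cartan decomposition and conjugation into one fixed diagonal subspace, it suffices to
   find, for every [a] in a fixed linear subspace of [R^n], a vector [b] in the same subspace,
   bounded independently of [a], with [b_i <= max (a_i, -1)]. Writing [D x] for the difference of [|x|^2] and its
   infimum on the orbit, each move decreases [(D |F|)^(1/4)] at least proportionally to the
   displacement, so the whole trajectory of [x] has length [O(|F x|^(1/2))]. This gives
   convergence, and makes the limit continuous at critical points. *)

Set Implicit Arguments.
Unset Strict Implicit.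
Unset Printing Implicit Defensive.
Import Order.TTheory GRing.Theory Num.Theory.
Import numFieldNormedType.Exports.
Local Open Scope classical_set_scope.
Local Open Scope ring_scope.

(** The logarithm [a] of [g^T g] is unbounded as [g] varies, while the bound must be linear in
    [|F x|] with a single constant; the truncation [b] supplies a bounded element of the Lie algebra
    to pair with [F x]. In a move of size [s], let [v] be the norm of the vector [(F x) x]. The
    displacement is of order [s v], while [D] falls by at least [s |F|^2] and [|F|^2] by at least
    [s v^2]. Neither fall alone dominates [s v]; the product [D |F|] combines them. The bound
    [D <= C |F|] then serves twice: it makes the fall of the fourth root linear in [s v], and it
    bounds that root by a multiple of [|F|^(1/2)], a quantity read off at the current point. The
    estimate is uniform in the starting point, so the tails of all nearby trajectories are
    controlled at once. *)

(** * The Frobenius inner product and norm *)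

Section Frobenius.
Context {R : realType}.

(** On column vectors this is the Euclidean scalar product, so vectors and matrices share the same
    lemmas. *)
Definition ip {m n} (A B : 'M[R]_(m, n)) : R := \tr (A^T *m B).
Definition frob {m n} (A : 'M[R]_(m, n)) : R := Num.sqrt (ip A A).

Lemma ipE m n (A B : 'M[R]_(m, n)) : ip A B = \sum_i \sum_j A i j * B i j.
Proof.
rewrite /ip /mxtrace exchange_big; apply: eq_bigr => j _.
by rewrite mxE; apply: eq_bigr => i _; rewrite mxE.
Qed.

Lemma ipC m n (A B : 'M[R]_(m, n)) : ip A B = ip B A.
Proof. by rewrite /ip -mxtrace_tr trmx_mul trmxK. Qed.

Lemma ipDr m n (A B C : 'M[R]_(m, n)) : ip A (B + C) = ip A B + ip A C.
Proof. by rewrite /ip mulmxDr mxtraceD. Qed.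

Lemma ipZr m n a (A B : 'M[R]_(m, n)) : ip A (a *: B) = a * ip A B.
Proof. by rewrite /ip -scalemxAr mxtraceZ. Qed.

Lemma ipNr m n (A B : 'M[R]_(m, n)) : ip A (- B) = - ip A B.
Proof. by rewrite -scaleN1r ipZr mulN1r. Qed.

Lemma ipDl m n (A B C : 'M[R]_(m, n)) : ip (A + B) C = ip A C + ip B C.
Proof. by rewrite ipC ipDr !(ipC C). Qed.

Lemma ipZl m n a (A B : 'M[R]_(m, n)) : ip (a *: A) B = a * ip A B.
Proof. by rewrite ipC ipZr ipC. Qed.

Lemma ipNl m n (A B : 'M[R]_(m, n)) : ip (- A) B = - ip A B.
Proof. by rewrite ipC ipNr ipC. Qed.

Definition ip_lin := (@ipDl, @ipDr, @ipNl, @ipNr, @ipZl, @ipZr).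

Lemma ip0r m n (A : 'M[R]_(m, n)) : ip A 0 = 0.
Proof. by rewrite -(scale0r 0) ipZr mul0r. Qed.

Lemma ip_sumr m n I (r : seq I) (P : pred I) (A : 'M[R]_(m, n)) F :
  ip A (\sum_(i <- r | P i) F i) = \sum_(i <- r | P i) ip A (F i).
Proof.
by elim/big_rec2: _ => [|i y1 y2 _ <-]; rewrite ?ip0r // ipDr.
Qed.

Lemma ip_suml m n I (r : seq I) (P : pred I) (A : 'M[R]_(m, n)) F :
  ip (\sum_(i <- r | P i) F i) A = \sum_(i <- r | P i) ip (F i) A.
Proof. by rewrite ipC ip_sumr; apply: eq_bigr => i _; rewrite ipC. Qed.

Lemma ip_mull m n p (A : 'M[R]_(m, n)) (B : 'M[R]_(n, p)) C :
  ip (A *m B) C = ip B (A^T *m C).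
Proof. by rewrite /ip trmx_mul mulmxA. Qed.

Lemma ip_mulr m n p (A : 'M[R]_(m, n)) (B : 'M[R]_(n, p)) C :
  ip (A *m B) C = ip A (C *m B^T).
Proof. by rewrite /ip trmx_mul mxtrace_mulC !mulmxA mxtrace_mulC mulmxA. Qed.

Lemma ip_tr m n (A B : 'M[R]_(m, n)) : ip A^T B^T = ip A B.
Proof. by rewrite /ip trmxK mxtrace_mulC -mxtrace_tr trmx_mul trmxK. Qed.

Lemma ip_outer n (A : 'M[R]_n) (x y : 'cV[R]_n) : ip A (x *m y^T) = ip (A *m y) x.
Proof. by rewrite ip_mulr. Qed.

Lemma ip_sqr m n (A : 'M[R]_(m, n)) : ip A A = \sum_i \sum_j A i j ^+ 2.
Proof. by rewrite ipE. Qed.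

Lemma ip_ge0 m n (A : 'M[R]_(m, n)) : 0 <= ip A A.
Proof. by rewrite ip_sqr; do 2!apply: sumr_ge0 => ? _; rewrite sqr_ge0. Qed.

Lemma ip_eq0 m n (A : 'M[R]_(m, n)) : ip A A = 0 -> A = 0.
Proof.
rewrite ip_sqr => /eqP; rewrite psumr_eq0 => [/allP A0|i _]; last first.
  by apply: sumr_ge0 => ? _; rewrite sqr_ge0.
apply/matrixP => i j; have /implyP/(_ isT) := A0 i (mem_index_enum _).
rewrite psumr_eq0 => [/allP/(_ j (mem_index_enum _))/=|? _]; last exact: sqr_ge0.
by rewrite sqrf_eq0 mxE => /eqP.
Qed.

Lemma frob_ge0 m n (A : 'M[R]_(m, n)) : 0 <= frob A.
Proof. exact: sqrtr_ge0. Qed.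

Lemma frob_sqr m n (A : 'M[R]_(m, n)) : frob A ^+ 2 = ip A A.
Proof. by rewrite sqr_sqrtr ?ip_ge0. Qed.

Lemma frob0 m n : frob (0 : 'M[R]_(m, n)) = 0.
Proof. by rewrite /frob ip0r sqrtr0. Qed.

Lemma frob_eq0 m n (A : 'M[R]_(m, n)) : frob A = 0 -> A = 0.
Proof. by move=> A0; apply: ip_eq0; rewrite -frob_sqr A0 expr0n. Qed.

Lemma frobN m n (A : 'M[R]_(m, n)) : frob (- A) = frob A.
Proof. by rewrite /frob ipNl ipNr opprK. Qed.

Lemma frobBC m n (A B : 'M[R]_(m, n)) : frob (A - B) = frob (B - A).
Proof. by rewrite -frobN opprB. Qed.

Lemma frobZ m n a (A : 'M[R]_(m, n)) : frob (a *: A) = `|a| * frob A.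
Proof. by rewrite /frob ipZl ipZr mulrA -expr2 sqrtrM ?sqr_ge0 // sqrtr_sqr. Qed.

Lemma frob_tr m n (A : 'M[R]_(m, n)) : frob A^T = frob A.
Proof. by rewrite /frob ip_tr. Qed.

Lemma ip_sqr_le m n (A B : 'M[R]_(m, n)) : ip A B ^+ 2 <= ip A A * ip B B.
Proof.
have [B0|Bn0] := eqVneq (ip B B) 0.
  by rewrite (ip_eq0 B0) !ip0r expr0n mulr0.
have Bp : 0 < ip B B by rewrite lt_def Bn0 ip_ge0.
have := ip_ge0 (ip B B *: A - ip A B *: B).
rewrite !ip_lin (ipC B A) => h.
have : 0 <= ip B B * (ip A A * ip B B - ip A B ^+ 2) by move: h; nra.
by rewrite pmulr_rge0 // subr_ge0.
Qed.

Lemma ip_norm_le m n (A B : 'M[R]_(m, n)) : `|ip A B| <= frob A * frob B.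
Proof.
rewrite -(@ler_pXn2r _ 2) ?nnegrE ?normr_ge0 ?mulr_ge0 ?frob_ge0 //.
by rewrite real_normK ?num_real // exprMn !frob_sqr ip_sqr_le.
Qed.

Lemma ip_le m n (A B : 'M[R]_(m, n)) : ip A B <= frob A * frob B.
Proof. exact: le_trans (ler_norm _) (ip_norm_le _ _). Qed.

Lemma frobD m n (A B : 'M[R]_(m, n)) : frob (A + B) <= frob A + frob B.
Proof.
rewrite -(@ler_pXn2r _ 2) ?nnegrE ?addr_ge0 ?frob_ge0 //.
rewrite sqrrD !frob_sqr !ip_lin (ipC B A).
by have := ip_le A B; nra.
Qed.

Lemma frobB m n (A B : 'M[R]_(m, n)) : frob (A - B) <= frob A + frob B.
Proof. by rewrite -(frobN B) frobD. Qed.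

Lemma frob_sum m n I (r : seq I) (P : pred I) (F : I -> 'M[R]_(m, n)) :
  frob (\sum_(i <- r | P i) F i) <= \sum_(i <- r | P i) frob (F i).
Proof.
elim/big_rec2: _ => [|i y1 y2 _ h]; first by rewrite frob0.
by apply: le_trans (frobD _ _) _; rewrite lerD2l.
Qed.

(** Each entry of the product pairs a row of [A] with a column of [B], so Cauchy-Schwarz entry by
    entry is enough. *)
Lemma frobM m n p (A : 'M[R]_(m, n)) (B : 'M[R]_(n, p)) :
  frob (A *m B) <= frob A * frob B.
Proof.
rewrite -(@ler_pXn2r _ 2) ?nnegrE ?mulr_ge0 ?frob_ge0 //.
rewrite exprMn !frob_sqr [ip (_ *m _) _]ip_sqr.
have -> : ip A A = \sum_i ip (row i A)^T (row i A)^T.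
  rewrite ip_sqr; apply: eq_bigr => i _; rewrite ip_tr ip_sqr big_ord1.
  by apply: eq_bigr => j _; rewrite !mxE.
have -> : ip B B = \sum_j ip (col j B) (col j B).
  rewrite ip_sqr exchange_big; apply: eq_bigr => i _; rewrite ip_sqr.
  by apply: eq_bigr => j _; rewrite big_ord1 !mxE.
rewrite mulr_suml; apply: ler_sum => i _; rewrite mulr_sumr; apply: ler_sum => j _.
apply: le_trans (ip_sqr_le _ _).
rewrite le_eqVlt; apply/orP; left; apply/eqP; congr (_ ^+ 2).
by rewrite ipE mxE; apply: eq_bigr => k _; rewrite big_ord1 !mxE.
Qed.

Lemma entry_le m n (A : 'M[R]_(m, n)) i j : `|A i j| <= frob A.
Proof.
rewrite -(@ler_pXn2r _ 2) ?nnegrE ?normr_ge0 ?frob_ge0 //.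
rewrite real_normK ?num_real // frob_sqr ip_sqr (bigD1 i) //= (bigD1 j) //=.
rewrite -addrA lerDl addr_ge0 //; first by apply: sumr_ge0 => ? _; exact: sqr_ge0.
by do 2!apply: sumr_ge0 => ? _; exact: sqr_ge0.
Qed.

Lemma frob_le_sum m n (A : 'M[R]_(m, n)) : frob A <= \sum_i \sum_j `|A i j|.
Proof.
rewrite {1}(matrix_sum_delta A); apply: le_trans (frob_sum _ _ _) _.
apply: ler_sum => i _; apply: le_trans (frob_sum _ _ _) _; apply: ler_sum => j _.
rewrite frobZ ler_piMr // /frob ip_sqr (bigD1 i) //= (bigD1 j) //= !mxE !eqxx /=.
rewrite !big1 ?addr0 ?expr1n ?sqrtr1 // => [k ki|k kj].
  by rewrite big1 // => l _; rewrite mxE (negbTE ki) expr0n.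
by rewrite mxE (negbTE kj) andbF expr0n.
Qed.

Definition orth {n} (Q : 'M[R]_n) : Prop := Q^T *m Q = 1%:M.

Lemma orthC n (Q : 'M[R]_n) : orth Q -> Q *m Q^T = 1%:M.
Proof. exact: mulmx1C. Qed.

Lemma orth_tr n (Q : 'M[R]_n) : orth Q -> orth Q^T.
Proof. by rewrite /orth trmxK; exact: orthC. Qed.

Lemma orthM n (P Q : 'M[R]_n) : orth P -> orth Q -> orth (P *m Q).
Proof. by rewrite /orth trmx_mul mulmxA -(mulmxA Q^T) => -> ; rewrite mulmx1. Qed.

Lemma ip_orthl m n (Q : 'M[R]_m) (A B : 'M[R]_(m, n)) :
  orth Q -> ip (Q *m A) (Q *m B) = ip A B.
Proof. by move=> oQ; rewrite ip_mull mulmxA oQ mul1mx. Qed.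

Lemma frob_orthl m n (Q : 'M[R]_m) (A : 'M[R]_(m, n)) : orth Q -> frob (Q *m A) = frob A.
Proof. by move=> oQ; rewrite /frob ip_orthl. Qed.

Lemma frob_orthr m n (Q : 'M[R]_n) (A : 'M[R]_(m, n)) :
  orth Q -> frob (A *m Q) = frob A.
Proof.
by move=> oQ; rewrite -frob_tr trmx_mul frob_orthl ?frob_tr //; exact: orth_tr.
Qed.

Lemma orth_mulK n p (Q : 'M[R]_n) (A : 'M[R]_(n, p)) : orth Q -> Q^T *m (Q *m A) = A.
Proof. by move=> oQ; rewrite mulmxA oQ mul1mx. Qed.

End Frobenius.

(** * Convergence of matrices, tested entrywise or in norm *)

Section MatrixLimits.
Context {R : realType} {T : Type} {F : set_system T} {FF : Filter F}.

Lemma cvg_mxP m n (f : T -> 'M[R]_(m, n)) (l : 'M[R]_(m, n)) :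
  f x @[x --> F] --> l <-> forall i j, f x i j @[x --> F] --> l i j.
Proof.
split=> [fl i j|fl A [P nP PA]].
  have /= := @continuous_cvg _ _ _ F FF f (fun M : 'M[R]_(m, n) => M i j) l
    (@coord_continuous R m n i j l) fl.
  exact.
rewrite /nbhs /=; near=> x; apply: PA; near: x.
apply: filter_forall => i; apply: filter_forall => j; exact: fl (nP i j).
Unshelve. all: end_near. Qed.

Lemma cvg_mulmx m n p (f : T -> 'M[R]_(m, n)) (g : T -> 'M[R]_(n, p))
    (a : 'M[R]_(m, n)) (b : 'M[R]_(n, p)) :
  f x @[x --> F] --> a -> g x @[x --> F] --> b -> f x *m g x @[x --> F] --> a *m b.
Proof.
move=> /cvg_mxP fa /cvg_mxP gb; apply/cvg_mxP => i j.
rewrite mxE; under eq_cvg do rewrite mxE.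
by apply: cvg_big => [|k _]; [exact: add_continuous|apply: cvgM].
Qed.

Lemma cvg_trmx m n (f : T -> 'M[R]_(m, n)) (a : 'M[R]_(m, n)) :
  f x @[x --> F] --> a -> (f x)^T @[x --> F] --> a^T.
Proof.
move=> /cvg_mxP fa; apply/cvg_mxP => i j; rewrite mxE.
under eq_cvg do rewrite mxE.
exact: fa.
Qed.

Lemma cvg_ip m n (f g : T -> 'M[R]_(m, n)) (a b : 'M[R]_(m, n)) :
  f x @[x --> F] --> a -> g x @[x --> F] --> b -> ip (f x) (g x) @[x --> F] --> ip a b.
Proof.
move=> /cvg_mxP fa /cvg_mxP gb; rewrite ipE; under eq_cvg do rewrite ipE.
do 2!(apply: cvg_big => [|? _]; first exact: add_continuous).
by apply: cvgM.
Qed.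

Lemma cvg_frob m n (f : T -> 'M[R]_(m, n)) (a : 'M[R]_(m, n)) :
  f x @[x --> F] --> a -> frob (f x) @[x --> F] --> frob a.
Proof.
move=> fa; have := @continuous_cvg _ _ _ F FF (fun x => ip (f x) (f x)) Num.sqrt (ip a a)
  (@sqrt_continuous R _) (cvg_ip fa fa).
exact.
Qed.

Lemma frob_cvg m n (f : T -> 'M[R]_(m, n)) (a : 'M[R]_(m, n)) (u : T -> R) :
  (\forall x \near F, frob (f x - a) <= u x) -> u x @[x --> F] --> 0 ->
  f x @[x --> F] --> a.
Proof.
move=> fu u0; apply/cvg_mxP => i j; apply/subr_cvg0; apply/norm_cvg0P.
apply: (squeeze_cvgr _ (cvg_cst 0) u0); near=> x.
rewrite normr_ge0 /=; apply: le_trans (near fu x _) => //.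
by have := entry_le (f x - a) i j; rewrite !mxE.
Unshelve. all: end_near. Qed.

Lemma cvg_frob0 m n (f : T -> 'M[R]_(m, n)) (a : 'M[R]_(m, n)) :
  f x @[x --> F] --> a -> frob (f x - a) @[x --> F] --> 0.
Proof.
move=> fa; rewrite -(@frob0 R m n) -(subrr a); apply: cvg_frob.
by apply: cvgB => //; exact: cvg_cst.
Qed.

End MatrixLimits.

Lemma frob_lim_le {R : realType} {T : Type} {F : set_system T} {FF : ProperFilter F}
    m n (f : T -> 'M[R]_(m, n)) (a : 'M[R]_(m, n)) (c : R) :
  f x @[x --> F] --> a -> (\forall x \near F, frob (f x) <= c) -> frob a <= c.
Proof.
move=> /cvg_frob fa fc; have <- := cvg_lim (@Rhausdorff R) fa.
by apply: limr_le => //; apply/cvg_ex; exists (frob a).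
Qed.

Lemma cvg_mx_unique {R : realType} {T : Type} {F : set_system T} {FF : ProperFilter F}
    m n (f : T -> 'M[R]_(m, n)) (a : 'M[R]_(m, n)) b :
  f x @[x --> F] --> a -> f x @[x --> F] --> b -> a = b.
Proof. by apply: cvg_unique; exact: norm_hausdorff. Qed.

(** * The matrix exponential *)

Section MatrixExponential.
Context {R : realType} {n : nat}.
Implicit Types A B P : 'M[R]_n.

Definition exps A N := \sum_(0 <= k < N) (k`!%:R)^-1 *: A ^+ k.
Definition mexp A : 'M[R]_n := \matrix_(i, j) limn (fun N => exps A N i j).

(** The exponent is a successor because the identity has Frobenius norm [sqrt n] instead of 1;
    constant terms of series are therefore treated apart below. *)
Lemma frobX A k : frob (A ^+ k.+1) <= frob A ^+ k.+1.
Proof.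
elim: k => [|k IH]; first by rewrite !expr1.
rewrite exprS [leRHS]exprS; apply: le_trans (frobM _ _) _.
by rewrite ler_wpM2l ?frob_ge0.
Qed.

Lemma entryX_le A k i j : `|(A ^+ k) i j| <= frob A ^+ k.
Proof.
case: k => [|k]; last exact: le_trans (entry_le _ _ _) (frobX _ _).
by rewrite !expr0 mxE; case: eqP; rewrite ?normr1 ?normr0.
Qed.

Lemma expsE A N i j : exps A N i j = \sum_(0 <= k < N) (k`!%:R)^-1 * (A ^+ k) i j.
Proof. by rewrite summxE; apply: eq_bigr => k _; rewrite mxE. Qed.

Lemma mexp_cvg A : exps A N @[N --> \oo] --> mexp A.
Proof.
apply/cvg_mxP => i j; rewrite mxE.
suff : cvgn (fun N => exps A N i j) by [].
have -> : (fun N => exps A N i j) = series (fun k => (k`!%:R)^-1 * (A ^+ k) i j).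
  by apply/funext => N; rewrite expsE.
apply: normed_cvg; apply: (@series_le_cvg _ _ (exp_coeff (frob A))) => [k|k|k|].
- exact: normr_ge0.
- by rewrite exp_coeff_ge0 ?frob_ge0.
- rewrite /= normrM normfV normr_nat mulrC ler_wpM2r ?invr_ge0 //.
  exact: entryX_le.
- exact: is_cvg_series_exp_coeff.
Qed.

Lemma mexpE A B : exps A N @[N --> \oo] --> B -> mexp A = B.
Proof. move=> h; have := cvg_mx_unique (@mexp_cvg A) h; exact. Qed.

Lemma mexp_seriesP A B : mexp A = B <-> forall i j e, 0 < e ->
  exists N, forall k, (N <= k)%N -> `|exps A k i j - B i j| < e.
Proof.
split=> [<- i j e e0|h].
  have h : exps A k i j @[k --> \oo] --> mexp A i j.
    by apply: (cvg_mxP _ _).1; exact: mexp_cvg.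
  move/cvgrPdist_lt: h => /(_ e e0)[N _ hN].
  by exists N => k Nk; rewrite distrC; exact: hN.
apply: mexpE; apply/cvg_mxP => i j; apply/cvgrPdist_lt => e e0.
by have [N hN] := h i j e e0; exists N => // k /= Nk; rewrite distrC; exact: hN.
Qed.

Lemma series_exp_le (a : R) N : 0 <= a -> series (exp_coeff a) N <= expR a.
Proof.
move=> a0; apply: nondecreasing_cvgn_le; last exact: is_cvg_series_exp_coeff.
by apply/nondecreasing_seqP => k; rewrite seriesSr lerDl exp_coeff_ge0.
Qed.

Lemma exps_rem A N : frob (exps A N.+2 - 1%:M - A) <= frob A ^+ 2 * expR (frob A).
Proof.
have a0 := frob_ge0 A; rewrite /exps !big_nat_recl //= fact0 invr1 scale1r scale1r.
rewrite expr0 expr1 -idmxE [1 + _]addrC addrK [A + _]addrC addrK.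
(* Since [k! <= (k + 2)!], the tail is dominated by [frob A ^+ 2] times the scalar exponential
   series. *)
apply: le_trans (frob_sum _ _ _) _.
apply: le_trans (ler_wpM2l (exprn_ge0 2 a0) (series_exp_le N a0)).
rewrite /series /= mulr_sumr; apply: ler_sum => k _.
rewrite frobZ ger0_norm ?invr_ge0 // mulrA -exprD add2n mulrC.
apply: ler_pM; rewrite ?frob_ge0 ?invr_ge0 ?frobX // lef_pV2 ?posrE ?ltr0n ?fact_gt0 //.
by rewrite ler_nat !factS mulnA leq_pmull.
Qed.

Lemma mexp_first_order A : frob (mexp A - 1%:M - A) <= frob A ^+ 2 * expR (frob A).
Proof.
apply: (@frob_lim_le _ _ \oo _ _ _ (fun N => exps A N - 1%:M - A)).
  by do 2!(apply: cvgB; last exact: cvg_cst); exact: mexp_cvg.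
near=> N; have N2 : (2 <= N)%N by near: N; exact: nbhs_infty_ge.
by rewrite -(subnK N2) addn2; exact: exps_rem.
Unshelve. all: end_near. Qed.

Lemma frobXB A B k :
  frob (A ^+ k.+1 - B ^+ k.+1) <= k.+1%:R * (frob A + frob B) ^+ k * frob (A - B).
Proof.
elim: k => [|k IH]; first by rewrite !expr1 expr0 !mul1r.
have -> : A ^+ k.+2 - B ^+ k.+2 = A *m (A ^+ k.+1 - B ^+ k.+1) + (A - B) *m B ^+ k.+1.
  by rewrite mulmxBr mulmxBl addrA subrK !exprS.
have [[a0 b0] d0] := (frob_ge0 A, frob_ge0 B, frob_ge0 (A - B)).
have ab0 := addr_ge0 a0 b0.
apply: le_trans (frobD _ _) _.
rewrite -[k.+2]addn1 natrD !mulrDl mul1r; apply: lerD.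
  apply: le_trans (frobM _ _) _; apply: le_trans (ler_wpM2l a0 IH) _.
  rewrite [_ ^+ k.+1]exprS !mulrA ler_wpM2r // ler_wpM2r ?exprn_ge0 //.
  by rewrite mulrC ler_wpM2l // lerDl.
apply: le_trans (frobM _ _) _; rewrite mulrC ler_wpM2r //.
by apply: le_trans (frobX _ _) _; apply: lerXn2r; rewrite ?nnegrE // lerDr.
Qed.

(** The factor [k + 1] of [frobXB] cancels against [(k + 1)!], which leaves the exponential series
    of [frob A + frob B]. *)
Lemma mexp_lip A B : frob (mexp A - mexp B) <= expR (frob A + frob B) * frob (A - B).
Proof.
have ab0 := addr_ge0 (frob_ge0 A) (frob_ge0 B).
apply: (@frob_lim_le _ _ \oo _ _ _ (fun N => exps A N - exps B N)).
  by apply: cvgB; exact: mexp_cvg.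
near=> N; rewrite -(@prednK N); last by near: N; exact: nbhs_infty_gt.
rewrite /exps !big_nat_recl //= opprD addrACA subrr add0r -sumrB.
apply: le_trans (frob_sum _ _ _) _.
apply: le_trans (ler_wpM2r (frob_ge0 _) (series_exp_le N.-1 ab0)).
rewrite /series /= mulr_suml; apply: ler_sum => k _.
rewrite -scalerBr frobZ ger0_norm ?invr_ge0 //.
apply: le_trans (ler_wpM2l _ (frobXB _ _ _)) _; first by rewrite invr_ge0.
rewrite !mulrA ler_wpM2r ?frob_ge0 // mulrC ler_wpM2l ?exprn_ge0 //.
by rewrite factS natrM invfM mulrAC mulVf ?mul1r // pnatr_eq0.
Unshelve. all: end_near. Qed.

Lemma cvg_mexp {T : Type} {F : set_system T} {FF : Filter F} (f : T -> 'M[R]_n) A :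
  f x @[x --> F] --> A -> mexp (f x) @[x --> F] --> mexp A.
Proof.
move=> fA; apply: (frob_cvg (u := fun x => expR (frob (f x) + frob A) * frob (f x - A))).
  by near=> x; exact: mexp_lip.
rewrite -(mulr0 (expR (frob A + frob A))); apply: cvgM; last exact: cvg_frob0.
apply: continuous_cvg; first exact: continuous_expR.
by apply: cvgD; [exact: cvg_frob|exact: cvg_cst].
Unshelve. all: end_near. Qed.



(** The triangle collects the terms of the Cauchy product of two series; the remaining corner is the
    error. *)
Lemma sum_square_triangle (V : zmodType) (f : nat -> nat -> V) N :
  \sum_(0 <= i < N) \sum_(0 <= j < N) f i j =
  \sum_(0 <= k < N) \sum_(0 <= i < k.+1) f i (k - i)%N +
  \sum_(0 <= i < N) \sum_(N - i <= j < N) f i j.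
Proof.
have -> : \sum_(0 <= k < N) \sum_(0 <= i < k.+1) f i (k - i)%N =
    \sum_(0 <= i < N) \sum_(0 <= j < N - i) f i j.
  elim: N => [|N IH]; first by rewrite !big_geq.
  rewrite big_nat_recr //= IH [RHS]big_nat_recr //= subSnn big_nat1.
  rewrite [X in _ + X]big_nat_recr //= subnn addrA -big_split /=; congr (_ + _).
  by apply: eq_big_nat => i /andP[_ iN]; rewrite subSn 1?ltnW // big_nat_recr.
rewrite -big_split /=; apply: eq_big_nat => i /andP[_ iN].
by rewrite -big_cat_nat ?leq_subr.
Qed.

Lemma exps_mul A B N : exps A N *m exps B N =
  \sum_(0 <= i < N) \sum_(0 <= j < N) ((i`!%:R)^-1 * (j`!%:R)^-1) *: (A ^+ i *m B ^+ j).
Proof.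
rewrite mulmx_suml; apply: eq_bigr => i _; rewrite mulmx_sumr; apply: eq_bigr => j _.
by rewrite -scalemxAl -scalemxAr scalerA.
Qed.

Lemma bin_invf k i : (i < k.+1)%N ->
  ('C(k, i)%:R : R) * (k`!%:R)^-1 = (i`!%:R)^-1 * ((k - i)`!%:R)^-1.
Proof.
move=> ik; rewrite -(bin_fact (m := i) (n := k)) // !natrM.
have fn0 m : (m`!%:R : R) != 0 by rewrite pnatr_eq0 -lt0n fact_gt0.
have c0 : ('C(k, i)%:R : R) != 0 by rewrite pnatr_eq0 -lt0n bin_gt0.
by field; rewrite c0 !fn0.
Qed.

Lemma binomial_exp A B k : A *m B = B *m A ->
  \sum_(0 <= i < k.+1) ((i`!%:R)^-1 * ((k - i)`!%:R)^-1) *: (A ^+ i *m B ^+ (k - i)) =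
  (k`!%:R)^-1 *: (A + B) ^+ k.
Proof.
move=> AB; have cBA : GRing.comm B A by rewrite /GRing.comm; exact: esym.
rewrite addrC exprDn_comm // scaler_sumr big_mkord; apply: eq_bigr => i _.
rewrite -bin_invf // -[(_ * _) *+ 'C(k, i)]scaler_nat scalerA [_^-1 * _]mulrC; congr (_ *: _).
by apply: commrX; apply: commr_sym; apply: commrX.
Qed.

Lemma binomial_expr (a b : R) k :
  \sum_(0 <= i < k.+1) ((i`!%:R)^-1 * ((k - i)`!%:R)^-1) * (a ^+ i * b ^+ (k - i)) =
  exp_coeff (a + b) k.
Proof.
rewrite /exp_coeff /= addrC exprDn mulr_suml big_mkord; apply: eq_bigr => i _.
by rewrite -bin_invf // -mulr_natr; ring.
Qed.

(** By the binomial formula the triangle cancels, for matrices and for scalars alike, so the corner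
    of the matrix double sum is dominated by that of the scalar one. The latter tends to 0 because
    [expR] is multiplicative. *)
Lemma exps_mulB A B N : A *m B = B *m A -> 
  frob (exps A N *m exps B N - exps (A + B) N) <=
  series (exp_coeff (frob A)) N * series (exp_coeff (frob B)) N -
  series (exp_coeff (frob A + frob B)) N.
Proof.
move=> AB; set a := frob A; set b := frob B.
have -> : series (exp_coeff a) N * series (exp_coeff b) N =
    \sum_(0 <= i < N) \sum_(0 <= j < N) ((i`!%:R)^-1 * (j`!%:R)^-1) * (a ^+ i * b ^+ j).
  rewrite /series /= mulr_suml; apply: eq_bigr => i _; rewrite mulr_sumr.
  by apply: eq_bigr => j _; rewrite /exp_coeff /=; ring.
rewrite exps_mul !sum_square_triangle.
rewrite (eq_bigr (fun k => (k`!%:R)^-1 *: (A + B) ^+ k)); last by move=> k _; exact: binomial_exp.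
rewrite [X in _ <= X + _ - _](eq_bigr (exp_coeff (a + b))); last by move=> k _; exact: binomial_expr.
rewrite ![_ + _ - _]addrAC !subrr !add0r.
apply: le_trans (frob_sum _ _ _) _; rewrite !big_nat; apply: ler_sum => i /andP[_ iN].
apply: le_trans (frob_sum _ _ _) _; rewrite !big_nat; apply: ler_sum => j /andP[ij jN].
rewrite frobZ ger0_norm ?mulr_ge0 ?invr_ge0 // ler_wpM2l ?mulr_ge0 ?invr_ge0 //.
(* In the corner [j] is positive, while [i] may be 0; in that case the identity factor is removed
   before norms are taken. *)
have j0 : (0 < j)%N by apply: leq_trans ij; rewrite subn_gt0.
rewrite -(prednK j0); case: i {iN ij} => [|i]; first by rewrite !expr0 mul1mx mul1r frobX.
by apply: le_trans (frobM _ _) _; apply: ler_pM; rewrite ?frob_ge0 ?frobX.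
Qed.

Lemma mexpD A B : A *m B = B *m A -> mexp (A + B) = mexp A *m mexp B.
Proof.
move=> AB; apply: mexpE.
have h : exps A N *m exps B N @[N --> \oo] --> mexp A *m mexp B.
  by apply: cvg_mulmx; exact: mexp_cvg.
have h0 : exps A N *m exps B N - exps (A + B) N @[N --> \oo] --> (0 : 'M[R]_n).
  apply: (frob_cvg (u := fun N => series (exp_coeff (frob A)) N * series (exp_coeff (frob B)) N
    - series (exp_coeff (frob A + frob B)) N)).
    by near=> N; rewrite subr0; exact: exps_mulB.
  rewrite -(subrr (expR (frob A + frob B))) {1}expRD.
  by apply: cvgB; [apply: cvgM|]; exact: is_cvg_series_exp_coeff.
rewrite (_ : exps (A + B) =
    fun N => exps A N *m exps B N - (exps A N *m exps B N - exps (A + B) N)).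
  have := cvgB h h0; rewrite subr0; exact.
by apply/funext => N; rewrite subKr.
Unshelve. all: end_near. Qed.

Lemma mexp0 : mexp (0 : 'M[R]_n) = 1%:M.
Proof.
apply: mexpE; apply: (frob_cvg (u := fun=> 0)); last exact: cvg_cst.
near=> N; rewrite -(@prednK N); last by near: N; exact: nbhs_infty_gt.
rewrite /exps big_nat_recl //= big1 => [|k _]; last by rewrite expr0n scaler0.
by rewrite addr0 expr0 fact0 invr1 scale1r subrr frob0.
Unshelve. all: end_near. Qed.

Lemma mexpNr A : mexp A *m mexp (- A) = 1%:M.
Proof. by rewrite -mexpD ?subrr ?mexp0 // mulmxN mulNmx. Qed.

Lemma mexpNl A : mexp (- A) *m mexp A = 1%:M.
Proof. exact: mulmx1C (mexpNr A). Qed.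

Lemma mexpX A k : mexp A ^+ k = mexp (k%:R *: A).
Proof.
elim: k => [|k IH]; first by rewrite scale0r mexp0.
rewrite exprS IH -[k.+1]add1n natrD scalerDl scale1r mexpD //.
by rewrite -scalemxAl -scalemxAr.
Qed.

Lemma mexp_tr A : mexp A^T = (mexp A)^T.
Proof.
apply: mexpE; rewrite (_ : exps A^T = fun N => (exps A N)^T).
  have := cvg_trmx (@mexp_cvg A); exact.
apply/funext => N; rewrite /exps linear_sum; apply: eq_bigr => k _ /=.
rewrite linearZ /=; congr (_ *: _); elim: k => [|k IH]; first by rewrite !expr0 -!idmxE trmx1.
by rewrite exprS exprSr trmx_mul IH.
Qed.

Lemma mexp_conj P Q A : Q *m P = 1%:M -> mexp (P *m A *m Q) = P *m mexp A *m Q.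
Proof.
move=> QP; apply: mexpE.
rewrite (_ : exps _ = fun N => P *m exps A N *m Q).
  by do 2?apply: cvg_mulmx; [exact: cvg_cst|exact: mexp_cvg|exact: cvg_cst].
apply/funext => N; rewrite /exps mulmx_sumr mulmx_suml; apply: eq_bigr => k _.
rewrite -scalemxAr -scalemxAl; congr (_ *: _).
elim: k => [|k IH]; first by rewrite !expr0 -!idmxE mulmx1 (mulmx1C QP).
by rewrite !exprS IH -!mulmxE !mulmxA -(mulmxA (P *m A)) QP mulmx1 -!mulmxA.
Qed.

Lemma mexp_diag (d : 'rV[R]_n) : mexp (diag_mx d) = diag_mx (map_mx expR d).
Proof.
apply: mexpE; apply/cvg_mxP => i j; rewrite !mxE.
have dX k : (diag_mx d ^+ k) i j = (d 0 j) ^+ k *+ (i == j).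
  elim: k i j => [|k IH] i' j'; first by rewrite !expr0 -idmxE mxE.
  rewrite exprSr -mulmxE mul_mx_diag mxE IH; case: (eqVneq i' j') => [_|_]; last by rewrite !mulr0n mul0r.
  by rewrite !mulr1n exprSr.
have -> : (fun N => exps (diag_mx d) N i j) =
    (fun N => series (exp_coeff (d 0 j)) N *+ (i == j)).
  apply/funext => N; rewrite expsE /series /= -sumrMnl; apply: eq_bigr => k _.
  by rewrite dX mulrnAr mulrC.
case: (eqVneq i j) => [->|_]; last exact: cvg_cst.
have := is_cvg_series_exp_coeff (d 0 j); exact.
Qed.

End MatrixExponential.

(** * Commuting conjugates and diagonalization, by maximizing over compact sets of orthogonal
    matrices *)

Section Conjugation.
Context {R : realType}.

Lemma cont_id (T : topologicalType) : continuous (@id T).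
Proof. by move=> x; exact: cvg_id. Qed.

Lemma cont_mulmx (T : topologicalType) m n p (f : T -> 'M[R]_(m, n)) (g : T -> 'M[R]_(n, p)) :
  continuous f -> continuous g -> continuous (fun x => f x *m g x).
Proof. by move=> cf cg x; apply: cvg_mulmx; [exact: cf|exact: cg]. Qed.

Lemma cont_trmx (T : topologicalType) m n (f : T -> 'M[R]_(m, n)) :
  continuous f -> continuous (fun x => (f x)^T).
Proof. by move=> cf x; apply: cvg_trmx; exact: cf. Qed.

Lemma cont_ip (T : topologicalType) m n (f g : T -> 'M[R]_(m, n)) :
  continuous f -> continuous g -> continuous (fun x => ip (f x) (g x)).
Proof. by move=> cf cg x; apply: cvg_ip; [exact: cf|exact: cg]. Qed.

Lemma closed_eq_mx m n p q (f g : 'M[R]_(m, n) -> 'M[R]_(p, q)) :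
  continuous f -> continuous g -> closed [set x | f x = g x].
Proof.
move=> cf cg; rewrite (_ : [set x | f x = g x] = (fun x => f x - g x) @^-1` [set 0]).
  apply: preimage_closed => [x _|]; first by have := cvgB (cf x) (cg x); exact.
  exact/accessible_closed_set1/hausdorff_accessible/norm_hausdorff.
by apply/seteqP; split=> x /= => [->|/eqP]; rewrite ?subrr // subr_eq0 => /eqP.
Qed.

Lemma vec_mx_continuous m n : continuous (@vec_mx R m n).
Proof.
move=> v; apply/(cvg_mxP (F := nbhs v)) => i j; rewrite mxE.
under eq_cvg do rewrite mxE.
have := @coord_continuous R 1 (m * n) 0 (mxvec_index i j) v; exact.
Qed.

Lemma frob_orth_sqr n (Q : 'M[R]_n) : orth Q -> frob Q ^+ 2 = n%:R.
Proof. by rewrite frob_sqr /ip => ->; rewrite mxtrace1. Qed.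

Lemma orth_closed n : closed [set Q : 'M[R]_n | orth Q].
Proof.
apply: (@closed_eq_mx n n n n (fun Q => Q^T *m Q) (fun=> 1%:M)); last exact: cst_continuous.
by apply: cont_mulmx; [apply: cont_trmx|]; exact: cont_id.
Qed.

(** Heine-Borel is applied to row vectors of length [n * n], hence the transport along [vec_mx]; an
    orthogonal matrix has squared norm [n]. *)
Lemma orth_compact n (K : set 'M[R]_n) :
  closed K -> (forall k, K k -> orth k) -> compact K.
Proof.
move=> Kc Ko; have -> : K = @vec_mx R n n @` [set v | K (vec_mx v)].
  apply/seteqP; split=> [k Kk|_ [v Kv <-]//].
  by exists (mxvec k); rewrite /= mxvecK.
apply: continuous_compact.
  by apply: continuous_subspaceT; exact: vec_mx_continuous.
apply: bounded_closed_compact; last first.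
  by apply: preimage_closed Kc => v _; exact: vec_mx_continuous.
exists (Num.sqrt n%:R); split; first exact: num_real.
move=> y /ltW ny v /Ko ov; apply: le_trans ny.
rewrite -(frob_orth_sqr ov) sqrtr_sqr ger0_norm ?frob_ge0 //.
rewrite [leLHS]/Num.norm /= mx_normrE; apply: bigmax_le => [|[i j] _ /=]; first exact: frob_ge0.
case/mxvec_indexP: j => j1 j2; rewrite (ord1 i).
by apply: le_trans (entry_le _ j1 j2); rewrite mxE.
Qed.

(** Divide by [s] and let it tend to 0; for positive [a], a single small [s] already gives the
    contradiction. *)
Lemma le0_of_small (a c : R) : (forall s, 0 < s <= 1 -> s * a <= c * s ^+ 2) -> a <= 0.
Proof.
move=> h; rewrite leNgt; apply/negP => a0.
pose s := a / (a + `|c| + `|c|).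
have c0 := normr_ge0 c; have cc := ler_norm c.
have d0 : 0 < a + `|c| + `|c| by lra.
have s0 : 0 < s by rewrite divr_gt0.
have s1 : s <= 1 by rewrite ler_pdivrMr //; lra.
have := h s; rewrite s0 s1 => /(_ isT); rewrite expr2 mulrCA ler_pM2l // => ac.
have sE : s * (a + `|c| + `|c|) = a by rewrite divfK ?gt_eqF.
nra.
Qed.

(* The first variation of [k |-> ip (k A k^T) H] at a maximum, in the direction of the
   skew matrix [Z = A' H - H A'], is [- ip Z Z]. *)
Lemma conj_commute n (K : set 'M[R]_n) (A H : 'M[R]_n) :
  closed K -> K 1%:M -> (forall k, K k -> orth k) -> A^T = A -> H^T = H ->
  (forall k t, K k ->
    K (mexp (t *: (k *m A *m k^T *m H - H *m (k *m A *m k^T))) *m k)) ->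
  exists2 k, K k & k *m A *m k^T *m H = H *m (k *m A *m k^T).
Proof.
move=> Kc K1 Ko As Hs Kexp.
pose phi k := ip (k *m A *m k^T) H.
have phic : {within K, continuous phi}.
  apply: continuous_subspaceT; apply: cont_ip; last exact: cst_continuous.
  apply: cont_mulmx; last by apply: cont_trmx; exact: cont_id.
  by apply: cont_mulmx; [exact: cont_id|exact: cst_continuous].
have [k /set_mem Kk kmax] := compact_EVT_max (ex_intro _ _ K1) (orth_compact Kc Ko) phic.
exists k => //; set A' := k *m A *m k^T.
have A's : A'^T = A' by rewrite !trmx_mul trmxK As mulmxA.
pose Z := A' *m H - H *m A'.
have Zs : Z^T = - Z by rewrite linearB /= (trmx_mul A') (trmx_mul H) A's Hs opprB.
suff : ip Z Z <= 0.
  move=> Z0; have : ip Z Z = 0 by apply/eqP; rewrite eq_le Z0 ip_ge0.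
  by move/ip_eq0/eqP; rewrite subr_eq0 => /eqP.
have ZHA : ip Z (H *m A') = - (ip Z Z / 2).
  have e1 : ip Z (A' *m H) = - ip Z (H *m A').
    by rewrite -ip_tr trmx_mul A's Hs Zs ipNl.
  have e2 : ip Z Z = ip Z (A' *m H) - ip Z (H *m A') by rewrite {2}/Z ipDr ipNr.
  by rewrite e2 e1; field.
pose z := frob Z; pose c := z ^+ 2 * expR z.
pose a := frob A'; pose h := frob H.
have z0 : 0 <= z by exact: frob_ge0.
have c0 : 0 <= c by rewrite mulr_ge0 ?sqr_ge0 ?expR_ge0.
apply: (@le0_of_small _ (2 * c * frob (H *m A') + (z + c) ^+ 2 * a * h)) => s /andP[s0 s1].
(* As the variation along [Z] is negative, the test curve runs along [- Z]: its first-order gain is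
   [s * ip Z Z], which by maximality must be absorbed by terms of order [s ^+ 2]. *)
pose E := mexp (- s *: Z).
pose r := E - 1%:M - (- s *: Z).
have sz : frob (- s *: Z) = s * z by rewrite frobZ normrN ger0_norm // ltW.
have rle : frob r <= c * s ^+ 2.
  apply: le_trans (mexp_first_order _) _; rewrite sz exprMn -mulrA mulrC ler_wpM2r ?sqr_ge0 //.
  by rewrite ler_wpM2l ?sqr_ge0 // ler_expR ler_piMl.
have E1le : frob (E - 1%:M) <= s * (z + c).
  have -> : E - 1%:M = r + (- s *: Z) by rewrite subrK.
  apply: le_trans (frobD _ _) _; rewrite sz.
  have : c * s ^+ 2 <= c * s by rewrite ler_wpM2l // expr2 ler_piMl // ltW.
  lra.
have := kmax (E *m k); rewrite inE => /(_ (Kexp _ _ Kk)).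
have -> : phi (E *m k) = ip (E *m A') (H *m E).
  rewrite /phi trmx_mul !mulmxA -[E *m k *m A]mulmxA -[E *m (k *m A) *m k^T]mulmxA.
  by rewrite ip_mulr trmxK.
have -> : E *m A' = A' + (E - 1%:M) *m A' by rewrite mulmxBl mul1mx addrC subrK.
have -> : H *m E = H + H *m (E - 1%:M) by rewrite mulmxBr mulmx1 addrC subrK.
rewrite ipDl (ipDr A' H) (ipDr (_ *m A') H) -/(phi k).
have -> : ip A' (H *m (E - 1%:M)) = ip (E - 1%:M) (H *m A').
  by rewrite ipC ip_mull Hs.
have -> : ip ((E - 1%:M) *m A') H = ip (E - 1%:M) (H *m A') by rewrite ip_mulr A's.
have -> : ip (E - 1%:M) (H *m A') = ip r (H *m A') + s * (ip Z Z / 2).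
  have -> : E - 1%:M = r + (- s *: Z) by rewrite subrK.
  by rewrite ipDl ipZl ZHA mulrNN.
have := ip_norm_le r (H *m A'); rewrite ler_norml => /andP[b1 _].
have := ip_norm_le ((E - 1%:M) *m A') (H *m (E - 1%:M)); rewrite ler_norml => /andP[b2 _].
have b3 : frob r * frob (H *m A') <= c * s ^+ 2 * frob (H *m A').
  by rewrite ler_wpM2r ?frob_ge0.
have b4 : frob ((E - 1%:M) *m A') * frob (H *m (E - 1%:M)) <=
    (s * (z + c)) ^+ 2 * a * h.
  have -> : (s * (z + c)) ^+ 2 * a * h = (s * (z + c) * a) * (h * (s * (z + c))) by ring.
  apply: ler_pM; rewrite ?frob_ge0 //; apply: le_trans (frobM _ _) _;
    by apply: ler_pM; rewrite ?frob_ge0.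
have -> : phi k = ip A' H by [].
move=> hmax; rewrite exprMn in b4; lra.
Qed.

(** Entrywise, commutation says [(h_i - h_j) M_ij = 0]. *)
Lemma comm_diag_mx n (M : 'M[R]_n) (h : 'rV[R]_n) :
  M *m diag_mx h = diag_mx h *m M <-> forall i j, h 0 i != h 0 j -> M i j = 0.
Proof.
rewrite mul_mx_diag mul_diag_mx; split=> [/matrixP Mh i j hij|Mh].
  have /eqP := Mh i j; rewrite !mxE mulrC -subr_eq0 -mulrBl mulf_eq0 subr_eq0 eq_sym.
  by rewrite (negbTE hij) => /eqP.
apply/matrixP => i j; rewrite !mxE mulrC.
by have [->//|/Mh->] := eqVneq (h 0 i) (h 0 j); rewrite !mulr0.
Qed.

Lemma skew_exp_orth n (Z : 'M[R]_n) t : Z^T = - Z -> orth (mexp (t *: Z)).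
Proof. by move=> Zs; rewrite /orth -mexp_tr linearZ /= Zs scalerN mexpNl. Qed.

Lemma mexp_comm n (Z B : 'M[R]_n) : Z *m B = B *m Z -> mexp Z *m B = B *m mexp Z.
Proof.
move=> ZB; have ek N : exps Z N *m B = B *m exps Z N.
  rewrite mulmx_suml mulmx_sumr; apply: eq_bigr => k _.
  rewrite -scalemxAl -scalemxAr; congr (_ *: _).
  by apply: commr_sym; apply: commrX; exact: esym.
have h1 : exps Z N *m B @[N --> \oo] --> mexp Z *m B.
  by apply: cvg_mulmx; [exact: mexp_cvg|exact: cvg_cst].
have h2 : exps Z N *m B @[N --> \oo] --> B *m mexp Z.
  by under eq_cvg do rewrite ek; apply: cvg_mulmx; [exact: cvg_cst|exact: mexp_cvg].
have := cvg_mx_unique h1 h2; exact.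
Qed.

Lemma conj_commutator_skew n (A H k : 'M[R]_n) : A^T = A -> H^T = H ->
  let A' := k *m A *m k^T in (A' *m H - H *m A')^T = - (A' *m H - H *m A').
Proof. by move=> As Hs /=; rewrite linearB /= !trmx_mul trmxK As Hs opprB !mulmxA. Qed.

Lemma comm_commutator n (M N P : 'M[R]_n) : M *m P = P *m M -> N *m P = P *m N ->
  (M *m N - N *m M) *m P = P *m (M *m N - N *m M).
Proof. by move=> MP NP; rewrite mulmxBl mulmxBr -!mulmxA NP MP !mulmxA MP NP. Qed.

(** With [K] the orthogonal matrices commuting with [diag_mx h], [conj_commute] rotates [B] by an
    element of [K] until it commutes with [D], whose diagonal entries are distinct; it is then
    diagonal. For [h = 0] this is the spectral theorem, obtained without characteristic
    polynomials. *)
Lemma spectral_block n (h : 'rV[R]_n) (B : 'M[R]_n) :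
  B^T = B -> B *m diag_mx h = diag_mx h *m B ->
  exists k b, [/\ orth k, k *m diag_mx h = diag_mx h *m k & k *m B *m k^T = diag_mx b].
Proof.
move=> Bs Bh; pose D : 'M[R]_n := diag_mx (\row_i (i%:R : R)).
pose K : set 'M[R]_n := [set k | orth k] `&` [set k | k *m diag_mx h = diag_mx h *m k].
have hs : (diag_mx h)^T = diag_mx h by exact: tr_diag_mx.
have Kc : closed K.
  apply: closedI; first exact: orth_closed.
  by apply: closed_eq_mx; apply: cont_mulmx; (exact: cont_id || exact: cst_continuous).
have K1 : K 1%:M by split; rewrite /= ?/orth ?trmx1 mulmx1 ?mul1mx.
have Ktr k : k *m diag_mx h = diag_mx h *m k -> k^T *m diag_mx h = diag_mx h *m k^T.
  by move=> /(congr1 trmx); rewrite !trmx_mul hs.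
have [||k [ok kh] kD] := @conj_commute n K B D Kc K1 (fun k => @proj1 _ _) Bs.
- exact: tr_diag_mx.
- move=> k t [ok kh]; set Z := (_ - _).
  have Zs : Z^T = - Z by apply: conj_commutator_skew => //; exact: tr_diag_mx.
  have Zh : Z *m diag_mx h = diag_mx h *m Z.
    have Ah : k *m B *m k^T *m diag_mx h = diag_mx h *m (k *m B *m k^T).
      by rewrite -mulmxA Ktr // mulmxA -(mulmxA k) Bh !mulmxA kh.
    have Dh : D *m diag_mx h = diag_mx h *m D by exact: diag_mxC.
    exact: comm_commutator.
  split; first by apply: orthM => //; exact: skew_exp_orth.
  rewrite /= -mulmxA kh !mulmxA mexp_comm // -scalemxAl Zh.
  by rewrite -scalemxAr.
exists k, (\row_i (k *m B *m k^T) i i); split => //.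
move: (k *m B *m k^T) kD => M kD; apply/matrixP => i j; rewrite [RHS]mxE.
case: (eqVneq i j) => [->|ij]; first by rewrite mxE mulr1n.
rewrite mulr0n; apply: (comm_diag_mx _ _).1 kD _ _ _.
by rewrite !mxE eqr_nat.
Qed.

Lemma spectral n (A : 'M[R]_n) : A^T = A ->
  exists Q d, orth Q /\ A = Q *m diag_mx d *m Q^T.
Proof.
move=> As; have [|k [b [ok _ kA]]] := @spectral_block n 0 A As.
  by rewrite linear0 mulmx0 mul0mx.
exists k^T, b; split; first exact: orth_tr.
by rewrite -kA trmxK !mulmxA ok mul1mx -mulmxA ok mulmx1.
Qed.

End Conjugation.

(** * The Lie algebra of a transpose-invariant algebraic matrix group *)

Section MatrixLieAlgebra.
Context {R : realType} {n : nat}.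

Inductive polyfun : ('M[R]_n -> R) -> Prop :=
| polyfun_entry i j : polyfun (fun g => g i j)
| polyfun_const c : polyfun (fun=> c)
| polyfun_add p q : polyfun p -> polyfun q -> polyfun (fun g => p g + q g)
| polyfun_mul p q : polyfun p -> polyfun q -> polyfun (fun g => p g * q g).

Lemma cvg_polyfun {T : Type} {F : set_system T} {FF : Filter F} p (f : T -> 'M[R]_n) (l : 'M[R]_n) :
  polyfun p -> f x @[x --> F] --> l -> p (f x) @[x --> F] --> p l.
Proof.
move=> pp fl; elim: pp => [i j|c|q r _ IHq _ IHr|q r _ IHq _ IHr].
- exact: (cvg_mxP _ _).1.
- exact: cvg_cst.
- exact: cvgD.
- exact: cvgM.
Qed.

Lemma polyfun_continuous p : polyfun p -> continuous p.
Proof.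
elim=> [i j|c|q r _ IHq _ IHr|q r _ IHq _ IHr].
- exact: coord_continuous.
- exact: cst_continuous.
- by move=> x; have := cvgD (IHq x) (IHr x); exact.
- by move=> x; have := cvgM (IHq x) (IHr x); exact.
Qed.

Definition zero_locus (S : set ('M[R]_n -> R)) : set 'M[R]_n :=
  [set g | g \in unitmx /\ forall p, S p -> p g = 0].

(** In contrast with [frobXB] the base is [1 + e]: for [e] of order [1 / k] the power [(1 + e) ^+ k]
    stays bounded, as the passage to [k]-th powers in [G_tangent] requires. *)
Lemma frobX_sub (g h : 'M[R]_n) e k : frob (g - 1%:M) <= e -> frob (h - 1%:M) <= e ->
  frob (g ^+ k - h ^+ k) <= k%:R * (1 + e) ^+ k * frob (g - h).
Proof.
move=> ge he; have e0 : 0 <= e by exact: le_trans (frob_ge0 _) ge.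
have e1 : 0 <= 1 + e by rewrite addr_ge0.
have gB (B : 'M[R]_n) : frob (g *m B) <= (1 + e) * frob B.
  have -> : g *m B = B + (g - 1%:M) *m B by rewrite mulmxBl mul1mx addrC subrK.
  apply: le_trans (frobD _ _) _; rewrite mulrDl mul1r lerD2l.
  by apply: le_trans (frobM _ _) _; rewrite ler_wpM2r ?frob_ge0.
have hB (B : 'M[R]_n) j : frob (B *m h ^+ j) <= (1 + e) ^+ j * frob B.
  elim: j => [|j IH]; first by rewrite !expr0 -idmxE mulmx1 mul1r.
  rewrite exprSr -mulmxE mulmxA.
  have -> : B *m h ^+ j *m h = B *m h ^+ j + B *m h ^+ j *m (h - 1%:M).
    by rewrite mulmxBr mulmx1 addrC subrK.
  apply: le_trans (frobD _ _) _; rewrite exprS -mulrA mulrDl mul1r.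
  apply: lerD => //; apply: le_trans (frobM _ _) _; rewrite mulrC.
  by apply: ler_pM; rewrite ?frob_ge0.
elim: k => [|k IH]; first by rewrite !expr0 subrr frob0 !mul0r.
have -> : g ^+ k.+1 - h ^+ k.+1 = g *m (g ^+ k - h ^+ k) + (g - h) *m h ^+ k.
  by rewrite mulmxBr mulmxBl addrA subrK !exprS.
apply: le_trans (frobD _ _) _; rewrite -[k.+1]addn1 natrD !mulrDl mul1r; apply: lerD.
  apply: le_trans (gB _) _; apply: le_trans (ler_wpM2l e1 IH) _.
  by rewrite addn1 exprS; lra.
apply: le_trans (hB _ _) _; rewrite ler_wpM2r ?frob_ge0 // addn1 exprS.
by rewrite ler_peMl ?exprn_ge0 // lerDl.
Qed.

Lemma mexpZ_order2 (X : 'M[R]_n) c : 0 <= c <= 1 ->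
  frob (mexp (c *: X) - 1%:M - c *: X) <= c ^+ 2 * (frob X ^+ 2 * expR (frob X)).
Proof.
move=> /andP[c0 c1]; apply: le_trans (mexp_first_order _) _.
rewrite frobZ ger0_norm // exprMn -mulrA ler_wpM2l ?sqr_ge0 // ler_wpM2l ?sqr_ge0 //.
by rewrite ler_expR ler_piMl ?frob_ge0.
Qed.

Lemma mexpZ_order1 (X : 'M[R]_n) c : 0 <= c <= 1 ->
  frob (mexp (c *: X) - 1%:M) <= c * (frob X + frob X ^+ 2 * expR (frob X)).
Proof.
move=> c01; have /andP[c0 c1] := c01.
have -> : mexp (c *: X) - 1%:M = (mexp (c *: X) - 1%:M - c *: X) + c *: X by rewrite subrK.
apply: le_trans (frobD _ _) _; rewrite frobZ ger0_norm //.
have q0 : 0 <= frob X ^+ 2 * expR (frob X) by rewrite mulr_ge0 ?sqr_ge0 ?expR_ge0.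
have cq : c ^+ 2 * (frob X ^+ 2 * expR (frob X)) <= c * (frob X ^+ 2 * expR (frob X)).
  by rewrite ler_wpM2r // expr2 ler_piMl.
have := mexpZ_order2 X c01; lra.
Qed.

Lemma invn_01 k : (0 < k)%N -> 0 <= (k%:R : R)^-1 <= 1.
Proof. by move=> k0; rewrite invr_ge0 ler0n invf_le1 ?ltr0n // ler1n. Qed.

(* Inverses are omitted: the elements inverted below are orthogonal or exponentials. *)
Record selfadjoint_group (G : set 'M[R]_n) : Prop := SelfadjointGroup {
  sag_locus : exists2 S, (forall p, S p -> polyfun p) & G = zero_locus S;
  sag1 : G 1%:M;
  sagM : forall g h, G g -> G h -> G (g *m h);
  sagT : forall g, G g -> G g^T
}.

Variable G : set 'M[R]_n.
Hypothesis HG : selfadjoint_group G.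

Let G1 := sag1 HG.
Let GM := sagM HG.
Let GT := sagT HG.

Definition lie (X : 'M[R]_n) : Prop := forall t, G (mexp (t *: X)).

(** [G] is cut out by polynomials only among invertible matrices, so the limit has to be known to be
    invertible. *)
Lemma G_lim {T : Type} {F : set_system T} {FF : ProperFilter F} (f : T -> 'M[R]_n) (l : 'M[R]_n) :
  f x @[x --> F] --> l -> (\forall x \near F, G (f x)) -> l \in unitmx -> G l.
Proof.
move=> fl Gf lu; have [S Spoly GS] := sag_locus HG; rewrite GS; split=> // p Sp.
have pl : p (f x) @[x --> F] --> p l by apply: cvg_polyfun (Spoly _ Sp) fl.
have p0 : p (f x) @[x --> F] --> (0 : R).
  apply: cvg_near_cst; near=> x.
  have Gx : G (f x) by near: x.
  by move: Gx; rewrite GS => -[_ ->].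
have := cvg_unique _ pl p0; exact.
Unshelve. all: end_near. Qed.

Lemma mexp_unit (X : 'M[R]_n) : mexp X \in unitmx.
Proof. by have /mulmx1_unit[] := mexpNr X. Qed.

Lemma GX g k : G g -> G (g ^+ k).
Proof. by move=> Gg; elim: k => [|k IH]; rewrite ?expr0 // exprS; exact: GM. Qed.

(** Both [g k] and [mexp (X / k)] equal [1 + X / k] up to order [k^-2], so their [k]-th powers
    differ by [O(1 / k)] and [g k ^+ k] tends to [mexp X]. The closure properties of the Lie algebra
    that need a limit all rest on this. *)
Lemma G_tangent (g : nat -> 'M[R]_n) X C :
  (forall k, (0 < k)%N -> G (g k) /\ frob (g k - 1%:M - k%:R^-1 *: X) <= k%:R^-1 ^+ 2 * C) ->
  G (mexp X).
Proof.
move=> gk; pose x := frob X; pose C' := x ^+ 2 * expR x; pose D := C + C' + x.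
have x0 : 0 <= x by exact: frob_ge0.
have C0 : 0 <= C.
  by have [_] := gk 1%N isT; rewrite invr1 expr1n mul1r; apply: le_trans; exact: frob_ge0.
have C'0 : 0 <= C' by rewrite mulr_ge0 ?sqr_ge0 ?expR_ge0.
apply: (@G_lim _ \oo _ (fun k => g k ^+ k)); last exact: mexp_unit.
  apply: (frob_cvg (u := fun k => (expR D * (C + C')) * k%:R^-1)); last first.
    rewrite -(mulr0 (expR D * (C + C'))); apply: cvgM; first exact: cvg_cst.
    have := @cvg_harmonic R; rewrite /harmonic => h.
    by rewrite -(cvg_shiftS (fun k => (k%:R : R)^-1)).
  near=> k; have k0 : (0 < k)%N by near: k; exact: nbhs_infty_gt.
  set c : R := k%:R^-1; have c01 := invn_01 k0; have /andP[c0 c1] := c01.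
  have kc : k%:R * c = 1 by rewrite mulfV // pnatr_eq0 -lt0n.
  have [_ gkC] := gk k k0.
  have -> : mexp X = mexp (c *: X) ^+ k by rewrite mexpX scalerA kc scale1r.
  have hC := mexpZ_order2 X c01.
  have hx := mexpZ_order1 X c01.
  have gD : frob (g k - 1%:M) <= c * D.
    have -> : g k - 1%:M = (g k - 1%:M - c *: X) + c *: X by rewrite subrK.
    apply: le_trans (frobD _ _) _; rewrite frobZ ger0_norm // -/x.
    have cC : c ^+ 2 * C <= c * C by rewrite ler_wpM2r // expr2 ler_piMl.
    have cC' : 0 <= c * C' by rewrite mulr_ge0.
    by apply: le_trans (lerD gkC (lexx _)) _; rewrite -/c /D; lra.
  have hD : frob (mexp (c *: X) - 1%:M) <= c * D.
    by apply: le_trans hx _; rewrite ler_wpM2l // -/x -/C' /D; lra.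
  apply: le_trans (frobX_sub k gD hD) _.
  have gh : frob (g k - mexp (c *: X)) <= c ^+ 2 * (C + C').
    have -> : g k - mexp (c *: X) =
        (g k - 1%:M - c *: X) - (mexp (c *: X) - 1%:M - c *: X).
      by have E (u v w : 'M[R]_n) : u - v - (w - v) = u - w; [rewrite opprB addrA subrK|rewrite !E].
    by apply: le_trans (frobB _ _) _; rewrite mulrDr; apply: lerD.
  have De : (1 + c * D) ^+ k <= expR D.
    have -> : expR D = expR (c * D) ^+ k by rewrite -expRM_natl mulrA kc mul1r.
    apply: lerXn2r; rewrite ?nnegrE ?expR_ge0 ?expR_ge1Dx //.
    by rewrite addr_ge0 // mulr_ge0 // /D; lra.
  apply: (@le_trans _ _ (k%:R * expR D * (c ^+ 2 * (C + C')))).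
    by apply: ler_pM; rewrite ?frob_ge0 ?ler_wpM2l // mulr_ge0 // exprn_ge0 // addr_ge0 // mulr_ge0 // /D; lra.
  rewrite le_eqVlt; apply/orP; left; apply/eqP.
  by transitivity (k%:R * c * (expR D * (C + C') * c)); [ring|rewrite kc mul1r].
by near=> k; apply: GX; have [] := gk k; first by near: k; exact: nbhs_infty_gt.
Unshelve. all: end_near. Qed.

Lemma lieZ a X : lie X -> lie (a *: X).
Proof. by move=> lX t; rewrite scalerA. Qed.

Lemma lieT X : lie X -> lie X^T.
Proof. by move=> lX t; rewrite -linearZ /= mexp_tr; exact: GT. Qed.

Lemma lie0 : lie 0.
Proof. by move=> t; rewrite scaler0 mexp0. Qed.

Lemma lieD X Y : lie X -> lie Y -> lie (X + Y).
Proof.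
move=> lX lY t; rewrite scalerDr; move: (lieZ t lX) (lieZ t lY).
move: (t *: X) (t *: Y) => {lX lY t}X {}Y lX lY.
pose r (Z : 'M[R]_n) := frob Z ^+ 2 * expR (frob Z).
(* Trotter products; the constant adds the cross term and the two second-order remainders. *)
apply: (@G_tangent (fun k => mexp (k%:R^-1 *: X) *m mexp (k%:R^-1 *: Y)) _
  ((frob X + r X) * (frob Y + r Y) + r X + r Y)) => k k0.
split; first by apply: GM; [exact: lX|exact: lY].
set c : R := k%:R^-1; have c01 := invn_01 k0; have /andP[c0 c1] := c01.
set E := mexp (c *: X); set F := mexp (c *: Y).
have -> : E *m F - 1%:M - c *: (X + Y) =
    (E - 1%:M) *m (F - 1%:M) + (E - 1%:M - c *: X) + (F - 1%:M - c *: Y).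
  rewrite mulmxBl mulmxBr mulmx1 mul1mx scalerDr.
  by apply/matrixP => i j; rewrite !mxE; ring.
apply: le_trans (frobD _ _) _; rewrite mulrDr; apply: lerD; last exact: mexpZ_order2.
apply: le_trans (frobD _ _) _; rewrite mulrDr; apply: lerD; last exact: mexpZ_order2.
apply: le_trans (frobM _ _) _.
have -> : c ^+ 2 * ((frob X + r X) * (frob Y + r Y)) =
  (c * (frob X + r X)) * (c * (frob Y + r Y)) by ring.
by apply: ler_pM; rewrite ?frob_ge0 //; exact: mexpZ_order1.
Qed.

Lemma lieN X : lie X -> lie (- X).
Proof. by rewrite -scaleN1r; exact: lieZ. Qed.

Lemma lieB X Y : lie X -> lie Y -> lie (X - Y).
Proof. by move=> lX lY; apply: lieD => //; exact: lieN. Qed.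

(** The rate [1 / k] keeps the error of order [k^-2] once [Xs k] is divided by [k] in
    [G_tangent]. *)
Lemma lie_lim (Xs : nat -> 'M[R]_n) X C :
  (forall k, (0 < k)%N -> lie (Xs k) /\ frob (Xs k - X) <= k%:R^-1 * C) -> lie X.
Proof.
move=> Xk t; pose D := `|t| * (frob X + C).
have C0 : 0 <= C.
  by have [_] := Xk 1%N isT; rewrite invr1 mul1r; apply: le_trans; exact: frob_ge0.
apply: (@G_tangent (fun k => mexp (k%:R^-1 *: (t *: Xs k))) _ (D ^+ 2 * expR D + `|t| * C)) => k k0.
have [lk kC] := Xk k k0; split; first by apply: lieZ.
set c : R := k%:R^-1; have c01 := invn_01 k0; have /andP[c0 c1] := c01.
have -> : mexp (c *: (t *: Xs k)) - 1%:M - c *: (t *: X) =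
    (mexp (c *: (t *: Xs k)) - 1%:M - c *: (t *: Xs k)) + c *: (t *: (Xs k - X)).
  by rewrite !scalerBr addrA subrK.
apply: le_trans (frobD _ _) _; rewrite mulrDr; apply: lerD; last first.
  rewrite !frobZ ger0_norm // expr2 -mulrA ler_wpM2l // mulrCA ler_wpM2l //.
apply: le_trans (mexpZ_order2 _ c01) _; rewrite ler_wpM2l ?sqr_ge0 //.
have kD : frob (t *: Xs k) <= D.
  rewrite frobZ ler_wpM2l //; have -> : Xs k = X + (Xs k - X) by rewrite addrC subrK.
  apply: le_trans (frobD _ _) _; rewrite lerD2l; apply: le_trans kC _.
  by rewrite ler_piMl.
apply: ler_pM; [exact: sqr_ge0|exact: expR_ge0| |by rewrite ler_expR].
by apply: lerXn2r; rewrite // nnegrE ?frob_ge0 // (le_trans _ kD) ?frob_ge0.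
Qed.

Lemma lie_conj g h X : G g -> G h -> h *m g = 1%:M -> lie X -> lie (g *m X *m h).
Proof.
move=> Gg Gh hg lX t.
by rewrite scalemxAl scalemxAr mexp_conj //; apply: GM => //; exact: GM.
Qed.

(** The bracket is the derivative at 0 of [mexp (s X) Y mexp (- s X)], a curve in the Lie algebra;
    its difference quotients at [s = 1 / k] converge at the rate that [lie_lim] asks for. *)
Lemma lie_bracket X Y : lie X -> lie Y -> lie (X *m Y - Y *m X).
Proof.
move=> lX lY; pose r (Z : 'M[R]_n) := frob Z ^+ 2 * expR (frob Z).
pose E (k : nat) := mexp ((k%:R^-1 : R) *: X); pose F (k : nat) := mexp ((k%:R^-1 : R) *: - X).
apply: (@lie_lim (fun k => k%:R *: (E k *m Y *m F k - Y)) _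
  (r X * frob Y + frob Y * r (- X) + (frob X + r X) * frob Y * (frob (- X) + r (- X)))) => k k0.
split.
  apply: lieZ; apply: lieB => //; apply: lie_conj => //.
  - exact: lX.
  - by rewrite /F; apply: lieN.
  - by rewrite /E /F scalerN mexpNl.
set c : R := k%:R^-1; have c01 := invn_01 k0; have /andP[c0 c1] := c01.
have kc : k%:R * c = 1 by rewrite mulfV // pnatr_eq0 -lt0n.
have -> : k%:R *: (E k *m Y *m F k - Y) - (X *m Y - Y *m X) =
    k%:R *: ((E k - 1%:M - c *: X) *m Y + Y *m (F k - 1%:M - c *: - X) +
      (E k - 1%:M) *m Y *m (F k - 1%:M)).
  have -> : X *m Y - Y *m X = k%:R *: (c *: (X *m Y - Y *m X)) by rewrite scalerA kc scale1r.
  rewrite -scalerBr; congr (_ *: _).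
  rewrite !mulmxBl !mulmxBr !mul1mx !mulmx1 -scalemxAl -scalemxAr mulmxN.
  by apply/matrixP => i j; rewrite !mxE; ring.
rewrite frobZ normr_nat.
set T := (X in c * X); rewrite [c * T](_ : _ = k%:R * (c ^+ 2 * T)); last first.
  by rewrite expr2 !mulrA kc mul1r.
rewrite ler_wpM2l // /T.
apply: le_trans (frobD _ _) _; rewrite mulrDr; apply: lerD.
  apply: le_trans (frobD _ _) _; rewrite mulrDr; apply: lerD.
    by apply: le_trans (frobM _ _) _; rewrite mulrA ler_wpM2r ?frob_ge0 //; exact: mexpZ_order2.
  by apply: le_trans (frobM _ _) _; rewrite mulrCA ler_wpM2l ?frob_ge0 //; exact: mexpZ_order2.
apply: le_trans (frobM _ _) _.
have -> : c ^+ 2 * ((frob X + r X) * frob Y * (frob (- X) + r (- X))) =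
  (c * (frob X + r X)) * frob Y * (c * (frob (- X) + r (- X))) by ring.
apply: ler_pM; rewrite ?frob_ge0 //; last exact: mexpZ_order1.
apply: le_trans (frobM _ _) _; rewrite ler_wpM2r ?frob_ge0 //; exact: mexpZ_order1.
Qed.

End MatrixLieAlgebra.

(** * Exponential sums that vanish at the natural numbers *)

Section ExponentialSums.
Context {R : realType}.

(* Subtracting [x0] times the hypothesis from its shift removes the node [x0]. *)
Lemma power_sums_eq0 (l : seq (R * R)) :
  (forall m, \sum_(p <- l) p.1 * p.2 ^+ m = 0) ->
  forall h : R -> R, \sum_(p <- l) p.1 * h p.2 = 0.
Proof.
have [N] := ubnP (size l); elim: N l => // N IH [|[c0 x0] l] /= lN lm h.
  by rewrite big_nil.
pose l' := [seq (p.1 * (p.2 - x0), p.2) | p <- l].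
pose h' x := (h x - h x0) / (x - x0).
have : \sum_(p <- l') p.1 * h' p.2 = 0.
  apply: IH => [|m]; first by rewrite size_map.
  have := lm m.+1; have := lm m; rewrite !big_cons /= => e0 e1.
  rewrite big_map /= (eq_bigr (fun p => p.1 * p.2 ^+ m.+1 - x0 * (p.1 * p.2 ^+ m))).
    rewrite sumrB -mulr_sumr.
    have -> : \sum_(p <- l) p.1 * p.2 ^+ m = - (c0 * x0 ^+ m) by lra.
    have -> : \sum_(p <- l) p.1 * p.2 ^+ m.+1 = - (c0 * x0 ^+ m.+1) by lra.
    by rewrite exprS; ring.
  by move=> p _; rewrite exprS; ring.
rewrite big_map /= (eq_bigr (fun p => p.1 * h p.2 - h x0 * p.1)); last first.
  move=> p _; rewrite /h'; have [->|px] := eqVneq p.2 x0; first by rewrite !subrr; ring.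
  by field; rewrite subr_eq0.
rewrite sumrB -mulr_sumr big_cons /= => e.
have := lm 0%N; rewrite big_cons /= expr0 mulr1.
rewrite (eq_bigr (fun p => p.1)); last by move=> p _; rewrite expr0 mulr1.
move=> e0; have -> : c0 = - \sum_(p <- l) p.1 by lra.
lra.
Qed.

(** At natural numbers these are power sums with nodes [expR p.2]; [power_sums_eq0] then allows any
    function of the nodes, here the power with exponent [t]. *)
Lemma expsum_eq0 (l : seq (R * R)) :
  (forall m : nat, \sum_(p <- l) p.1 * expR (m%:R * p.2) = 0) ->
  forall t, \sum_(p <- l) p.1 * expR (t * p.2) = 0.
Proof.
move=> lm t; have := @power_sums_eq0 [seq (p.1, expR p.2) | p <- l] _ (fun x => expR (t * ln x)).
rewrite big_map /= => h; rewrite -[RHS]h; last first.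
  by move=> m; rewrite big_map /= -[RHS](lm m); apply: eq_bigr => p _; rewrite expRM_natl.
by apply: eq_bigr => p _; rewrite expRK.
Qed.

Lemma mexp_spectral n (Q : 'M[R]_n) (a : 'rV[R]_n) t : orth Q ->
  mexp (t *: (Q *m diag_mx a *m Q^T)) = Q *m diag_mx (map_mx expR (t *: a)) *m Q^T.
Proof.
by move=> oQ; rewrite scalemxAl scalemxAr -linearZ /= mexp_conj ?mexp_diag.
Qed.

Lemma spectral_entry n (Q : 'M[R]_n) (a : 'rV[R]_n) i j :
  (Q *m diag_mx a *m Q^T) i j = \sum_k Q i k * Q j k * a 0 k.
Proof.
by rewrite mul_mx_diag mxE; apply: eq_bigr => k _; rewrite !mxE mulrAC.
Qed.

Lemma polyfun_expsum n (Q : 'M[R]_n) (a : 'rV[R]_n) p : orth Q -> polyfun p ->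
  exists l : seq (R * R), forall t,
    p (mexp (t *: (Q *m diag_mx a *m Q^T))) = \sum_(x <- l) x.1 * expR (t * x.2).
Proof.
move=> oQ; elim=> [i j|c|q r _ [lq hq] _ [lr hr]|q r _ [lq hq] _ [lr hr]].
- exists [seq (Q i k * Q j k, a 0 k) | k <- index_enum 'I_n] => t.
  rewrite mexp_spectral // spectral_entry big_map; apply: eq_bigr => k _.
  by rewrite !mxE.
- by exists [:: (c, 0)] => t; rewrite big_seq1 /= mulr0 expR0 mulr1.
- by exists (lq ++ lr) => t; rewrite big_cat hq hr.
- exists [seq (x.1 * y.1, x.2 + y.2) | x <- lq, y <- lr] => t.
  rewrite hq hr big_allpairs_dep mulr_suml; apply: eq_bigr => x _.
  rewrite mulr_sumr; apply: eq_bigr => y _ /=.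
  by rewrite mulrDr expRD; ring.
Qed.

End ExponentialSums.

(** * Cartan decomposition and conjugation into one diagonal subspace *)

Section CartanDecomposition.
Context {R : realType} {n : nat}.
Variable G : set 'M[R]_n.
Hypothesis HG : selfadjoint_group G.

(** Along [t |-> mexp (t A)] with [A] symmetric, a polynomial becomes an exponential sum; it
    vanishes at all natural [t], hence everywhere. Closedness of the group would not suffice: the
    integral powers of 2 form a closed group of 1 by 1 matrices with trivial Lie algebra. *)
Lemma lie_of_powers (Q : 'M[R]_n) (a : 'rV[R]_n) : orth Q ->
  G (mexp (Q *m diag_mx a *m Q^T)) -> lie G (Q *m diag_mx a *m Q^T).
Proof.
move=> oQ Ge t; have [S Spoly GS] := sag_locus HG.
have Gm (m : nat) : G (mexp (m%:R *: (Q *m diag_mx a *m Q^T))).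
  by rewrite -mexpX; exact: GX.
rewrite GS; split=> [|p Sp]; first exact: mexp_unit.
have [l hl] := polyfun_expsum a oQ (Spoly p Sp).
rewrite hl; apply: expsum_eq0 => m; rewrite -hl.
by have := Gm m; rewrite GS => -[_]; apply.
Qed.

Lemma ip_diag_spectral (Q : 'M[R]_n) (a : 'rV[R]_n) (x : 'cV[R]_n) :
  ip (Q *m diag_mx a *m Q^T *m x) x = \sum_i a 0 i * (Q^T *m x) i 0 ^+ 2.
Proof.
rewrite -!mulmxA ip_mull ipE; apply: eq_bigr => i _.
by rewrite big_ord1 mul_diag_mx mxE expr2 mulrA.
Qed.

(** [A] is the logarithm of the positive definite matrix [g^T *m g], taken in an eigenbasis. The
    orthogonal factor of [g] can be left out because [g^T *m g] determines the norm of [g *m x]. *)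
Lemma cartan g : G g -> exists A, [/\ A^T = A, lie G A & g^T *m g = mexp A].
Proof.
move=> Gg; have gu : g \in unitmx by have [S _ GS] := sag_locus HG; move: Gg; rewrite GS => -[].
have [|Q [d [oQ gQ]]] := @spectral _ _ (g^T *m g); first by rewrite trmx_mul trmxK.
have dE i : d 0 i = ip (g *m col i Q) (g *m col i Q).
  rewrite ip_mull mulmxA gQ ipC ip_diag_spectral.
  have -> : Q^T *m col i Q = col i 1%:M by rewrite -oQ colE mulmxA -colE.
  rewrite (bigD1 i) //= big1 => [|j ji]; rewrite !mxE ?eqxx ?expr1n ?mulr1 ?addr0 //.
  by rewrite (negbTE ji) expr0n mulr0.
have d0 i : 0 < d 0 i.
  rewrite dE lt_def ip_ge0 andbT; apply/eqP => /ip_eq0 gq0.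
  have q0 : col i Q = 0 by rewrite -(mulKmx gu (col i Q)) gq0 mulmx0.
  have : (Q^T *m Q) i i = 0.
    rewrite mxE big1 // => j _; rewrite !mxE.
    by have /matrixP/(_ j 0) := q0; rewrite !mxE => ->; rewrite mulr0.
  by rewrite oQ mxE eqxx => /eqP; rewrite oner_eq0.
pose a := map_mx (@ln R) d.
have aE : mexp (Q *m diag_mx a *m Q^T) = g^T *m g.
  rewrite -[_ *m Q^T]scale1r mexp_spectral // gQ; congr (_ *m diag_mx _ *m _).
  by apply/matrixP => i j; rewrite !mxE mul1r (ord1 i) lnK // posrE.
exists (Q *m diag_mx a *m Q^T); split => //.
  by rewrite !trmx_mul trmxK tr_diag_mx mulmxA.
apply: lie_of_powers => //; rewrite aE; apply: (sagM HG) => //; exact: (sagT HG).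
Qed.

(** Orthogonality implies invertibility, so this set is closed among all matrices although [G] need
    not be. *)
Lemma maxcpt_closed : closed (G `&` [set k | orth k]).
Proof.
have [S Spoly GS] := sag_locus HG.
have -> : G `&` [set k | orth k] =
    (\bigcap_(p in S) (p @^-1` [set 0])) `&` [set k | orth k].
  apply/seteqP; split=> k [h ok]; split=> //.
    by move=> p Sp; move: h; rewrite GS => -[_]; apply.
  by rewrite GS; split=> //; have /mulmx1_unit[] := ok.
apply: closedI; last exact: orth_closed.
apply: closed_bigI => p Sp; apply: preimage_closed => [x _|].
  exact: polyfun_continuous (Spoly p Sp) x.
exact/accessible_closed_set1/hausdorff_accessible/Rhausdorff.
Qed.

Lemma lie_conj_orth k B : G k -> orth k -> lie G B -> lie G (k *m B *m k^T).
Proof. by move=> Gk ok; apply: lie_conj => //; exact: (sagT HG). Qed.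

(** The direction of variation in [conj_commute] is a bracket, hence in the Lie algebra, and it is
    skew; so its exponential stays in the maximal compact subgroup. *)
Lemma conj_commute_lie A H : A^T = A -> lie G A -> H^T = H -> lie G H ->
  exists k, [/\ G k, orth k & k *m A *m k^T *m H = H *m (k *m A *m k^T)].
Proof.
move=> As lA Hs lH.
have [|||k [Gk ok] kH] := @conj_commute _ _ (G `&` [set k | orth k]) A H maxcpt_closed _ _ As Hs.
- by split; [exact: (sag1 HG)|rewrite /= /orth trmx1 mulmx1].
- by move=> k [].
- move=> k t [Gk ok]; split.
    by apply: (sagM HG) => //; apply: (lie_bracket HG) => //; exact: lie_conj_orth.
  by apply: orthM => //; apply: skew_exp_orth; exact: conj_commutator_skew.
by exists k.
Qed.


Definition diag_pairs (h : 'rV[R]_n) := #|[set ij : 'I_n * 'I_n | h 0 ij.1 != h 0 ij.2]%SET|.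

(* Maximality plays the role of regularity: perturbing by a commuting element cannot split
   any further pair of eigenvalues. *)
Lemma exists_regular : exists Q h, [/\ orth Q, lie G (Q *m diag_mx h *m Q^T) &
  forall P b, orth P -> lie G (P *m diag_mx b *m P^T) -> (diag_pairs b <= diag_pairs h)%N].
Proof.
pose good N := `[< exists Q h, [/\ orth Q, lie G (Q *m diag_mx h *m Q^T) & diag_pairs h = N] >].
have [|N|N /asboolP[Q [h [oQ lQ hN]]] Nmax] := @ex_maxnP good #|{: 'I_n * 'I_n}|.
- exists (diag_pairs 0); apply/asboolP; exists 1%:M, 0; split=> //.
    by rewrite /orth trmx1 mulmx1.
  by rewrite linear0 mulmx0 mul0mx; exact: lie0.
- by move=> /asboolP[Q [h [_ _ <-]]]; exact: max_card.
exists Q, h; split=> // P b oP lP; rewrite hN; apply: Nmax.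
by apply/asboolP; exists P, b.
Qed.

Lemma avoid_finite (s : seq R) : exists2 e, e != 0 & e \notin s.
Proof.
have b0 : 0 <= \sum_(x <- s) `|x| by apply: sumr_ge0.
have [e eE] : exists e, e = 1 + \sum_(x <- s) `|x| by eexists.
exists e; first by rewrite eE gt_eqF // ltr_pwDl.
apply/negP => es; have : `|e| <= \sum_(x <- s) `|x|.
  by rewrite (big_rem _ es) /= lerDl; apply: sumr_ge0.
by have := ler_norm e; rewrite {1}eE; lra.
Qed.

(** Diagonalizing [B] inside the eigenspaces of the regular element gives [b]. If [b] separated a
    pair that [h] does not, some [h + e *: b] would exceed the maximal number of separated pairs. So
    [b] is constant on these eigenspaces, and the rotation [k] commutes with it and drops out. *)
Lemma regular_centralizer Q h B : orth Q -> lie G (Q *m diag_mx h *m Q^T) ->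
  (forall P b, orth P -> lie G (P *m diag_mx b *m P^T) -> (diag_pairs b <= diag_pairs h)%N) ->
  B^T = B -> lie G B ->
  B *m (Q *m diag_mx h *m Q^T) = Q *m diag_mx h *m Q^T *m B ->
  exists b, B = Q *m diag_mx b *m Q^T.
Proof.
move=> oQ lH hmax Bs lB BH; pose B' := Q^T *m B *m Q.
have B's : B'^T = B' by rewrite !trmx_mul trmxK Bs mulmxA.
have BE : B = Q *m B' *m Q^T by rewrite /B' !mulmxA orthC // mul1mx -mulmxA orthC // mulmx1.
have B'h : B' *m diag_mx h = diag_mx h *m B'.
  have -> : B' *m diag_mx h = Q^T *m (B *m (Q *m diag_mx h *m Q^T)) *m Q.
    by rewrite /B' -!mulmxA oQ mulmx1.
  by rewrite BH /B' !mulmxA oQ mul1mx.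
have [k [b [ok kh kB]]] := spectral_block B's B'h.
have okT := orth_tr ok.
have B'E : B' = k^T *m diag_mx b *m k.
  by rewrite -kB !mulmxA ok mul1mx -mulmxA ok mulmx1.
have hE : diag_mx h = k^T *m diag_mx h *m k by rewrite -mulmxA -kh mulmxA ok mul1mx.
have bh i j : h 0 i = h 0 j -> b 0 i = b 0 j.
  move=> hij; apply/eqP/negP => /negP bij.
  (* The listed ratios are the [e] for which [h + e *: b] merges a pair that [b] separates; where
     [b] takes equal values the entry is a harmless 0. *)
  have [e e0 es] := avoid_finite [seq (h 0 x.2 - h 0 x.1) / (b 0 x.1 - b 0 x.2) |
    x <- index_enum ('I_n * 'I_n)%type].
  have := hmax (Q *m k^T) (h + e *: b) (orthM oQ okT).
  have -> : Q *m k^T *m diag_mx (h + e *: b) *m (Q *m k^T)^T =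
      Q *m diag_mx h *m Q^T + e *: B.
    rewrite trmx_mul trmxK linearD linearZ /= mulmxDr mulmxDl {2}hE BE B'E.
    by rewrite -!scalemxAr -!scalemxAl !mulmxA.
  have lHB : lie G (Q *m diag_mx h *m Q^T + e *: B) by apply: lieD => //; exact: lieZ.
  move=> /(_ lHB); rewrite leqNgt => /negP; apply; apply: proper_card.
  apply/properP; split.
    apply/fintype.subsetP => x; rewrite !inE !mxE => hx; apply/eqP => hbx.
    have [bx|bx] := eqVneq (b 0 x.1) (b 0 x.2).
      by move: hbx; rewrite bx => /addIr/eqP; rewrite (negbTE hx).
    move/mapP: es; apply; exists x; first exact: mem_index_enum.
    have bx' : b 0 x.1 - b 0 x.2 != 0 by rewrite subr_eq0.
    apply: (mulIf bx'); rewrite divfK //; lra.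
  exists (i, j); rewrite inE ?mxE /= hij ?eqxx //.
  by rewrite (inj_eq (addrI _)) (inj_eq (mulfI e0)).
exists b; rewrite BE; congr (_ *m _ *m _).
have kb : k *m diag_mx b = diag_mx b *m k.
  apply/comm_diag_mx => i j bij; apply: (comm_diag_mx _ _).1 kh _ _ _.
  by apply: contraNneq bij => /bh ->.
by rewrite B'E -mulmxA -kb mulmxA ok mul1mx.
Qed.

(* Substitute for the conjugacy of the maximal abelian subspaces of the symmetric part. *)
Lemma conj_torus : exists2 Q, orth Q & forall A, A^T = A -> lie G A ->
  exists k a, [/\ G k, orth k & k *m A *m k^T = Q *m diag_mx a *m Q^T].
Proof.
have [Q [h [oQ lH hmax]]] := exists_regular.
exists Q => // A As lA.
have Hs : (Q *m diag_mx h *m Q^T)^T = Q *m diag_mx h *m Q^T.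
  by rewrite !trmx_mul trmxK tr_diag_mx mulmxA.
have [k [Gk ok kH]] := conj_commute_lie As lA Hs lH.
have [||b kA] := @regular_centralizer Q h (k *m A *m k^T) oQ lH hmax _ _ kH.
- by rewrite !trmx_mul trmxK As mulmxA.
- exact: lie_conj_orth.
by exists k, b.
Qed.

End CartanDecomposition.

(** * Truncation inside a linear subspace, by sign patterns *)

Section ConformalReduction.
Context {R : realType} {n : nat}.
Variable L : set 'rV[R]_n.
Hypothesis LD : forall a b, L a -> L b -> L (a + b).
Hypothesis LZ : forall t a, L a -> L (t *: a).

Let supp (a : 'rV[R]_n) := [set i | a 0 i != 0]%SET.
Let signs (a : 'rV[R]_n) : {set 'I_n} * {set 'I_n} := ([set i | 0 < a 0 i]%SET, [set i | a 0 i < 0]%SET).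

(** There are finitely many sign patterns, and fixing one vector for each is what bounds [b]
    independently of [a]. A pattern met by no nonzero vector of [L] gets 0, whence the premise
    [L 0]. *)
Lemma sign_representative (s : {set 'I_n} * {set 'I_n}) :
  exists u, [/\ L 0 -> L u,
    forall i, (0 < u 0 i -> i \in s.1) /\ (u 0 i < 0 -> i \in s.2 /\ u 0 i <= -1) &
    forall a, L a -> a != 0 -> signs a = s -> u != 0].
Proof.
have [[a [La a0 sa]]|na] := pselect (exists a, [/\ L a, a != 0 & signs a = s]); last first.
  exists 0; split=> // [i|a La a0 sa]; first by rewrite mxE ltxx.
  by case: na; exists a.
(* Large enough to scale every negative entry to at most -1; zero entries contribute [0^-1 = 0]. *)
pose c := \sum_i `|a 0 i|^-1.
have cge i : `|a 0 i|^-1 <= c.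
  by rewrite /c (bigD1 i) //= lerDl; apply: sumr_ge0 => j _; rewrite invr_ge0.
have c0 : 0 < c.
  have /rV0Pn[i ai] := a0; apply: lt_le_trans (cge i).
  by rewrite invr_gt0 normr_gt0.
exists (c *: a); split=> [_|i|b _ _ _]; first exact: LZ.
- rewrite mxE pmulr_rgt0 // pmulr_rlt0 //; split=> ai; first by rewrite -sa inE.
  split; first by rewrite -sa inE.
  have : 1 <= c * `|a 0 i| by rewrite -ler_pdivrMr ?normr_gt0 ?lt_eqF // mul1r.
  by rewrite ltr0_norm // mulrN; lra.
by rewrite scaler_eq0 negb_or a0 andbT gt_eqF.
Qed.

(* Induct on the support: subtract from [a] the largest multiple of the representative [u] of
   its sign pattern that keeps the signs; in [b] that multiple is truncated at [1]. *)
Lemma bounded_below_truncation : exists2 C, 0 <= C & forall a, L a ->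
  exists b, [/\ L b, forall i, b 0 i <= Num.max (a 0 i) (-1) & forall i, `|b 0 i| <= C].
Proof.
have [u uP] := choice sign_representative.
suff H N : exists2 C, 0 <= C & forall a, L a -> (#|supp a| <= N)%N ->
    exists b, [/\ L b, forall i, b 0 i <= Num.max (a 0 i) (-1) & forall i, `|b 0 i| <= C].
  have [C C0 HC] := H n; exists C => // a La; apply: HC => //.
  by rewrite -[leqRHS]card_ord; exact: max_card.
elim: N => [|N [C C0 HC]].
  exists 0 => // a La; rewrite leqn0 cards_eq0 => /eqP a0.
  have {}a0 : a = 0.
    apply/rowP => i; rewrite mxE; apply/eqP/negbFE.
    by have /setP/(_ i) := a0; rewrite !inE.
  exists a; split=> // i; first by rewrite le_max lexx.
  by rewrite a0 mxE normr0.
pose CU := \sum_s \sum_i `|u s 0 i|.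
have uC s i : `|u s 0 i| <= CU.
  rewrite /CU (bigD1 s) //= (bigD1 i) //= -addrA lerDl addr_ge0 //; first exact: sumr_ge0.
  by apply: sumr_ge0 => ? _; exact: sumr_ge0.
have CU0 : 0 <= CU by apply: sumr_ge0 => ? _; exact: sumr_ge0.
exists (C + CU); first exact: addr_ge0.
move=> a La aN; have [a0|a0] := eqVneq a 0.
  by exists a; split=> // i; rewrite ?le_max ?lexx // a0 mxE normr0 addr_ge0.
have L0 : L 0 by rewrite -(scale0r a); exact: LZ.
have [/(_ L0) Lu us /(_ a La a0 erefl) u0] := uP (signs a).
move: us Lu u0 (uC (signs a)); move: (u (signs a)) => v vs Lv v0 vC.
have vpos i : 0 < v 0 i -> 0 < a 0 i by move/(vs i).1; rewrite inE.
have vneg i : v 0 i < 0 -> a 0 i < 0 /\ v 0 i <= -1 by move/(vs i).2; rewrite inE.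
have /rV0Pn[i0 vi0] := v0.
pose f i := a 0 i / v 0 i.
(* The least ratio is the largest multiple of [v] that can be subtracted from [a] without reversing
   a sign; it makes entry [i1] vanish, so the support shrinks. *)
have [i1 vi1 fmin] := @arg_minP _ _ _ i0 (fun i => v 0 i != 0) f vi0.
pose s := f i1.
have s0 : 0 < s.
  rewrite /s /f; case: (ltgtP (v 0 i1) 0) vi1 => // h _.
    by have [a1 _] := vneg _ h; rewrite nmulr_rgt0 ?invr_lt0.
  by rewrite divr_gt0 // vpos.
pose a' := a - s *: v.
have a'E i : a' 0 i = a 0 i - s * v 0 i by rewrite !mxE.
have La' : L a' by rewrite /a' -scaleN1r; apply: LD => //; apply: LZ; exact: LZ.
have a'p i : 0 < v 0 i -> 0 <= a' 0 i.
  by move=> vi; rewrite a'E subr_ge0 -ler_pdivlMr //; apply: fmin; rewrite gt_eqF.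
have a'n i : v 0 i < 0 -> a' 0 i <= 0.
  by move=> vi; rewrite a'E subr_le0 -ler_ndivlMr //; apply: fmin; rewrite lt_eqF.
have [|b' [Lb' b'a b'C]] := HC a' La'.
  rewrite -ltnS; apply: leq_trans aN; apply: proper_card; apply/properP; split.
    apply/fintype.subsetP => i; rewrite !inE a'E; apply: contraNneq => ai.
    have [vi|vi|->] := ltgtP (v 0 i) 0; last by rewrite ai mulr0 subr0.
      by have [] := vneg i vi; rewrite ai ltxx.
    by have := vpos i vi; rewrite ai ltxx.
  exists i1; rewrite !inE.
    by apply: contraNneq vi1 => ai; move: s0; rewrite /s /f ai mul0r ltxx.
  by rewrite a'E negbK /s /f divfK // subrr.
(* For [s > 1] one copy of [v] suffices: where [v] is negative it is at most -1 and [b'] is at most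
   0, and where [v] is positive a smaller multiple only helps. *)
pose m := Num.min s 1.
have m0 : 0 <= m by rewrite le_min ler01 ltW.
have m1 : m <= 1 by rewrite ge_min lexx orbT.
have ms : m <= s by rewrite ge_min lexx.
exists (b' + m *: v); split=> [|i|i].
- by apply: LD => //; exact: LZ.
- rewrite !mxE; have := b'a i; rewrite !le_max.
  have aE : a 0 i = a' 0 i + s * v 0 i by rewrite a'E subrK.
  have [vi|vi|vi] := ltgtP (v 0 i) 0; last 1 first.
  + by rewrite aE vi !mulr0 !addr0.
  + have := a'n i vi; have [_ v1] := vneg i vi.
    have [s1|s1] := leP s 1.
      have -> : m = s by rewrite /m; apply/min_idPl.
      by rewrite aE => a'i /orP[h|h]; apply/orP; [left; lra|right; nra].
    have -> : m = 1 by rewrite /m; apply/min_idPr; exact: ltW.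
    by move=> a'i /orP[h|h]; apply/orP; right; lra.
  have := a'p i vi; rewrite aE => a'i /orP[h|h]; apply/orP; left.
    by apply: lerD => //; rewrite ler_pM2r.
  by apply: lerD; [lra|rewrite ler_pM2r].
- rewrite !mxE; apply: le_trans (ler_normD _ _) _; apply: lerD => //.
  rewrite normrM ger0_norm //; apply: le_trans (vC i).
  by rewrite ler_piMl.
Qed.

End ConformalReduction.

(** * Orthogonal projection onto a linear subspace of matrices *)

Section Riesz.
Context {R : realType} {n : nat}.
Variable P : set 'M[R]_n.
Hypothesis P0 : P 0.
Hypothesis PD : forall A B, P A -> P B -> P (A + B).
Hypothesis PZ : forall t A, P A -> P (t *: A).

Lemma ip_mxvec (A B : 'M[R]_n) : ip A B = (mxvec A *m (mxvec B)^T) 0 0.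
Proof.
rewrite ipE mxE pair_bigA /= (reindex _ (curry_mxvec_bij n n)) /=.
by apply: eq_bigr => -[i j] _; rewrite mxE !mxvecE.
Qed.

Let orthonormal k (E : 'I_k -> 'M[R]_n) :=
  (forall i, P (E i)) /\ forall i j, ip (E i) (E j) = (i == j)%:R.

(** The flattened matrices are the rows of a matrix with [n * n] columns, and the Gram identity
    gives it rank [k]. *)
Lemma orthonormal_bound k (E : 'I_k -> 'M[R]_n) : orthonormal E -> (k <= n * n)%N.
Proof.
move=> [_ oE]; pose M : 'M[R]_(k, n * n) := \matrix_i mxvec (E i).
have M1 : M *m M^T = 1%:M.
  apply/matrixP => i j; rewrite [RHS]mxE -oE ip_mxvec !mxE.
  by apply: eq_bigr => l _; rewrite !mxE.
by rewrite -(mxrank1 R k) -M1; apply: leq_trans (mxrankM_maxl _ _) (rank_leq_col _).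
Qed.

Lemma sum_closed (I : Type) (r : seq I) (F : I -> 'M[R]_n) :
  (forall i, P (F i)) -> P (\sum_(i <- r) F i).
Proof. by move=> PF; elim/big_ind: _ => // A B; exact: PD. Qed.

(** [P] comes without a basis, so an orthonormal family of maximal length is taken. A nonzero
    residue of some [B] in [P], once normalized, would extend it. *)
Lemma subspace_projection (M : 'M[R]_n) :
  exists2 F, P F & forall B, P B -> ip F B = ip M B.
Proof.
pose good k := `[< exists E : 'I_k -> 'M[R]_n, orthonormal E >].
have [|k|k /asboolP[E [PE oE]] kmax] := @ex_maxnP good (n * n).
- by exists 0%N; apply/asboolP; exists (fun=> 0); split=> [|[]].
- by move=> /asboolP[E]; exact: orthonormal_bound.
have sumE B j : ip (\sum_i ip B (E i) *: E i) (E j) = ip B (E j).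
  rewrite ip_suml (bigD1 j) //= big1 => [|i ij]; rewrite ipZl oE ?eqxx ?mulr1 ?addr0 //.
  by rewrite (negbTE ij) mulr0.
have Psum B : P (\sum_i ip B (E i) *: E i) by apply: sum_closed => i; exact: PZ.
exists (\sum_i ip M (E i) *: E i) => // B PB.
pose C := B - \sum_i ip B (E i) *: E i.
have PC : P C by apply: PD => //; rewrite -scaleN1r; exact: PZ.
have CE j : ip C (E j) = 0 by rewrite ipDl ipNl sumE subrr.
suff C0 : C = 0.
  have -> : B = \sum_i ip B (E i) *: E i by apply/eqP; rewrite -subr_eq0 -/C C0.
  by rewrite !ip_sumr; apply: eq_bigr => i _; rewrite !ipZr sumE.
apply/eqP/negP => /negP C0.
have c0 : frob C != 0 by apply: contraNneq C0 => /frob_eq0 ->.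
pose c := (frob C)^-1.
have cC : ip (c *: C) (c *: C) = 1.
  by rewrite ipZl ipZr -frob_sqr /c; field.
pose E' (i : 'I_k.+1) := if unlift ord_max i is Some j then E j else c *: C.
suff /kmax : good k.+1 by rewrite ltnn.
apply/asboolP; exists E'; split=> [i|i j]; rewrite /E'.
  by case: unliftP => [j _|_]; [exact: PE|exact: PZ].
case: unliftP => [i' ->|->]; case: unliftP => [j' ->|->].
- by rewrite oE (inj_eq lift_inj).
- by rewrite ipZr ipC CE mulr0 eq_sym (negbTE (neq_lift _ _)).
- by rewrite ipZl CE mulr0 (negbTE (neq_lift _ _)).
- by rewrite cC eqxx.
Qed.

End Riesz.

(** * Estimates for one move along a symmetric matrix *)

Section StepEstimates.
Context {R : realType} {n : nat}.
Variables (A : 'M[R]_n) (x : 'cV[R]_n) (s : R).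
Hypothesis As : A^T = A.
Hypothesis s0 : 0 <= s.
Hypothesis sA : 16 * (s * frob A) <= 1.

Let y := mexp (- s *: A) *m x.

(** Compare with [1 / (1 + t)]: the product [(1 + t) (1 - t + 2 t^2)] equals [1 + t^2 (1 + 2 t)],
    which is at least 1 when [t >= - 1 / 2]. *)
Lemma expRN_le (t : R) : - 2^-1 <= t -> expR (- t) <= 1 - t + 2 * t ^+ 2.
Proof.
move=> t2; have e1 := expR_ge1Dx t; have t1 : 0 < 1 + t by lra.
have : expR (- t) <= (1 + t)^-1 by rewrite expRN lef_pV2 ?posrE ?expR_gt0.
move/le_trans; apply; rewrite -div1r ler_pdivrMr //.
have := sqr_ge0 t; nra.
Qed.

Lemma expRN_sub_sqr (t : R) : `|t| <= 2^-1 -> (expR (- t) - 1) ^+ 2 <= (2 * t) ^+ 2.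
Proof.
rewrite ler_norml => /andP[t1 t2].
have := expRN_le t1; have := expR_ge1Dx (- t) => e1 e2.
have [t0|t0] := leP 0 t.
  have e3 : expR (- t) <= 1 by rewrite -expR0 ler_expR oppr_le0.
  nra.
have e3 : 1 <= expR (- t) by rewrite -expR0 ler_expR; lra.
have e4 : expR (- t) - 1 <= - (2 * t) by nra.
nra.
Qed.

Lemma step_spectral : exists z l, [/\
    ip x x = \sum_i z i ^+ 2 /\ ip y y = \sum_i (expR (- (s * l i)) * z i) ^+ 2,
    ip (A *m x) x = \sum_i l i * z i ^+ 2 /\
      ip (A *m y) y = \sum_i l i * (expR (- (s * l i)) * z i) ^+ 2,
    ip (A *m x) (A *m x) = \sum_i (l i * z i) ^+ 2,
    ip (y - x) (y - x) = \sum_i ((expR (- (s * l i)) - 1) * z i) ^+ 2 &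
    forall i : 'I_n, - 16^-1 <= s * l i <= 16^-1].
Proof.
have [Q [d [oQ AE]]] := spectral As.
pose z := Q^T *m x; have oQT := orth_tr oQ.
have QE (u : 'cV[R]_n) : ip u u = \sum_i (Q^T *m u) i 0 ^+ 2.
  by rewrite -(ip_orthl _ _ oQT) ip_sqr; apply: eq_bigr => i _; rewrite big_ord1.
have zy : Q^T *m y = diag_mx (map_mx expR (- s *: d)) *m z.
  by rewrite /y AE mexp_spectral // -!mulmxA orth_mulK.
have zyi i : (Q^T *m y) i 0 = expR (- (s * d 0 i)) * z i 0.
  by rewrite zy mul_diag_mx !mxE mulNr.
exists (fun i => z i 0), (fun i => d 0 i); split.
- by rewrite !QE; split=> //; apply: eq_bigr => i _; rewrite zyi.
- rewrite AE !ip_diag_spectral; split=> //; apply: eq_bigr => i _.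
  by rewrite zyi.
- rewrite QE; apply: eq_bigr => i _.
  by rewrite AE -!mulmxA orth_mulK // mul_diag_mx mxE.
- rewrite QE; apply: eq_bigr => i _.
  by rewrite mulmxBr [X in X ^+ 2]mxE zyi [X in _ + X]mxE -/z mulrBl mul1r.
move=> i; rewrite -ler_norml normrM (ger0_norm s0).
suff h : s * `|d 0 i| <= s * frob A.
  by apply: le_trans h _; rewrite -[16^-1]div1r ler_pdivlMr ?ltr0n // mulrC.
rewrite ler_wpM2l //; have -> : frob A = frob (diag_mx d) by rewrite AE frob_orthr // frob_orthl.
by have := entry_le (diag_mx d) i i; rewrite mxE eqxx mulr1n.
Qed.

Lemma step_norm : 2 * s * ip (A *m x) x - 8 * s ^+ 2 * ip (A *m x) (A *m x) <= ip x x - ip y y.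
Proof.
have [z [l [[-> ->] [-> _] -> _ lb]]] := step_spectral.
rewrite !mulr_sumr -!sumrB; apply: ler_sum => i _.
have /andP[l1 l2] := lb i.
have h : expR (- (2 * (s * l i))) <= 1 - 2 * (s * l i) + 2 * (2 * (s * l i)) ^+ 2.
  by apply: expRN_le; lra.
rewrite [X in _ <= _ - X]exprMn -expRM_natl mulrN.
have := ler_wpM2r (sqr_ge0 (z i)) h; lra.
Qed.

Lemma step_form : ip (A *m y) y <= ip (A *m x) x - 3 / 2 * s * ip (A *m x) (A *m x).
Proof.
have [z [l [_ [-> ->] -> _ lb]]] := step_spectral.
rewrite mulr_sumr -sumrB; apply: ler_sum => i _.
have /andP[l1 l2] := lb i.
set t := 2 * (s * l i).
have e1 : expR (- t) <= 1 - t + 2 * t ^+ 2 by apply: expRN_le; rewrite /t; lra.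
have e2 := expR_ge1Dx (- t).
rewrite [X in l i * X <= _]exprMn -expRM_natl mulrN -/t.
suff : l i * expR (- t) <= l i - 3 / 2 * s * l i ^+ 2.
  by move=> h; have := ler_wpM2r (sqr_ge0 (z i)) h; lra.
(* A nonnegative [l i] requires the upper bound on the exponential, whose quadratic term lowers the
   coefficient 2 to [3 / 2] because [s * l i <= 1 / 16]; a negative one requires only the lower
   bound. *)
have [li|li] := leP 0 (l i).
  apply: le_trans (ler_wpM2l li e1) _; rewrite /t.
  have : s * l i ^+ 2 * (s * l i) <= s * l i ^+ 2 * 16^-1.
    by rewrite ler_wpM2l // mulr_ge0 ?sqr_ge0.
  have := mulr_ge0 s0 (sqr_ge0 (l i)); lra.
have : l i * expR (- t) <= l i * (1 - t) by rewrite ler_wnM2l // ltW.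
rewrite /t; have := mulr_ge0 s0 (sqr_ge0 (l i)); lra.
Qed.

Lemma step_dist : frob (y - x) <= 2 * s * frob (A *m x).
Proof.
have [z [l [_ _ Axx yx lb]]] := step_spectral.
rewrite -(@ler_pXn2r _ 2) ?nnegrE ?mulr_ge0 ?frob_ge0 //.
rewrite exprMn !frob_sqr yx Axx mulr_sumr; apply: ler_sum => i _.
rewrite [leLHS]exprMn.
rewrite [leRHS](_ : _ = (2 * (s * l i)) ^+ 2 * z i ^+ 2); last by ring.
rewrite ler_wpM2r ?sqr_ge0 //; apply: expRN_sub_sqr.
by have /andP[l1 l2] := lb i; rewrite ler_norml; apply/andP; split; lra.
Qed.

End StepEstimates.

(** * The moment map and the global bound on the loss of norm along orbits *)

Section MomentMap.
Context {R : realType} {n : nat}.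
Variable G : set 'M[R]_n.
Hypothesis HG : selfadjoint_group G.

Definition sym_lie (B : 'M[R]_n) : Prop := lie G B /\ B^T = B.

Lemma sym_lieD A B : sym_lie A -> sym_lie B -> sym_lie (A + B).
Proof. by move=> [lA As] [lB Bs]; split; [exact: lieD|rewrite linearD /= As Bs]. Qed.

Lemma sym_lieZ t A : sym_lie A -> sym_lie (t *: A).
Proof. by move=> [lA As]; split; [exact: lieZ|rewrite linearZ /= As]. Qed.

Lemma sym_lie0 : sym_lie 0.
Proof. by split; [exact: lie0|rewrite linear0]. Qed.

(** The moment map is the orthogonal projection of [x *m x^T] onto the symmetric part of the Lie
    algebra. *)
Lemma moment_exists (x : 'cV[R]_n) :
  exists2 F, sym_lie F & forall B, sym_lie B -> ip F B = ip (B *m x) x.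
Proof.
have [F lF FE] := subspace_projection sym_lie0 sym_lieD sym_lieZ (x *m x^T).
by exists F => // B /FE ->; rewrite ipC ip_outer.
Qed.

Definition moment (x : 'cV[R]_n) : 'M[R]_n := sval (cid2 (moment_exists x)).

Lemma moment_lie x : sym_lie (moment x).
Proof. by rewrite /moment; case: cid2. Qed.

Lemma momentE x B : sym_lie B -> ip (moment x) B = ip (B *m x) x.
Proof. by rewrite /moment; case: cid2 => F /= _; apply. Qed.

Lemma moment_unique x F : sym_lie F -> (forall B, sym_lie B -> ip F B = ip (B *m x) x) ->
  F = moment x.
Proof.
move=> lF FE; apply/eqP; rewrite -subr_eq0; apply/eqP/ip_eq0.
have l : sym_lie (F - moment x).
  by apply: sym_lieD => //; rewrite -scaleN1r; apply: sym_lieZ; exact: moment_lie.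
by rewrite ipDl ipNl FE // momentE // subrr.
Qed.

Lemma sym_lie_conj k B : G k -> orth k -> sym_lie B -> sym_lie (k *m B *m k^T).
Proof.
move=> Gk ok [lB Bs]; split; first exact: lie_conj_orth.
by rewrite !trmx_mul trmxK Bs mulmxA.
Qed.

Lemma moment_equivariant k x : G k -> orth k -> moment (k *m x) = k *m moment x *m k^T.
Proof.
move=> Gk ok; apply/esym/moment_unique; first exact/sym_lie_conj/moment_lie.
move=> B lB; have lB' : sym_lie (k^T *m B *m k).
  rewrite -{2}(trmxK k); apply: sym_lie_conj => //; last exact: orth_tr.
  exact: (sagT HG).
rewrite ip_mulr trmxK ip_mull mulmxA momentE //.
by rewrite -!mulmxA ip_mull trmxK.
Qed.

(** Test the difference [D] against itself: [|D|^2 = <D x, x> - <D y, y>], and this difference of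
    quadratic forms factors through [x - y]. *)
Lemma moment_lip x y : frob (moment x - moment y) <= frob (x - y) * (frob x + frob y).
Proof.
pose D := moment x - moment y.
have lD : sym_lie D.
  apply: sym_lieD; first exact: moment_lie.
  by rewrite -scaleN1r; apply: sym_lieZ; exact: moment_lie.
have [_ Ds] := lD.
have e : ip D D = ip (D *m (x - y)) x + ip (D *m y) (x - y).
  rewrite {1}/D ipDl ipNl !momentE // mulmxBr !ip_lin (ip_mull D y x) Ds ipC (ipC y); ring.
have b1 : ip (D *m (x - y)) x <= frob D * frob (x - y) * frob x.
  by apply: le_trans (ip_le _ _) _; rewrite ler_wpM2r ?frob_ge0 ?frobM.
have b2 : ip (D *m y) (x - y) <= frob D * frob y * frob (x - y).
  by apply: le_trans (ip_le _ _) _; rewrite ler_wpM2r ?frob_ge0 ?frobM.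
have [D0|D0] := eqVneq (frob D) 0.
  by rewrite -/D D0 mulr_ge0 ?addr_ge0 ?frob_ge0.
have Dp : 0 < frob D by rewrite lt_def D0 frob_ge0.
rewrite -/D -(ler_pM2l Dp) -expr2 frob_sqr e; lra.
Qed.

Lemma moment0 : moment 0 = 0.
Proof.
apply: esym; apply: moment_unique; first exact: sym_lie0.
by move=> B _; rewrite ip0r ipC ip0r.
Qed.

Lemma moment_le x : frob (moment x) <= frob x ^+ 2.
Proof. by have := moment_lip x 0; rewrite moment0 !subr0 frob0 addr0 expr2. Qed.

(** The skew part of [X] contributes nothing to [<X x, x>], and [X + X^T] stays in the Lie algebra
    by invariance under transposition. *)
Lemma moment_eq0P x : moment x = 0 <-> forall X, lie G X -> ip (X *m x) x = 0.
Proof.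
split=> [F0 X lX|h].
  have lB : sym_lie (X + X^T).
    split; first by apply: lieD => //; exact: lieT.
    by rewrite linearD /= trmxK addrC.
  have := momentE x lB; rewrite F0 ipC ip0r mulmxDl ipDl [ip (X^T *m x) x]ip_mull trmxK (ipC x).
  lra.
apply/ip_eq0; have [lF _] := moment_lie x.
by rewrite momentE ?h //; exact: moment_lie.
Qed.

(** With [g^T g = mexp A] and [A] conjugated by [k] to the exponents [a], the left side is the sum
    of [(1 - expR a_i) z_i^2]. The truncation [b] bounds it by [- <B' x, x> = - <F x, B'>], where
    [B'] has norm at most [n C]. *)
Lemma key_inequality : exists2 C, 0 < C &
  forall g x, G g -> ip x x - ip (g *m x) (g *m x) <= C * frob (moment x).
Proof.
have [Q oQ conjQ] := conj_torus HG.
pose L : set 'rV[R]_n := [set a | lie G (Q *m diag_mx a *m Q^T)].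
have LD a b : L a -> L b -> L (a + b).
  move=> la lb.
  have e : Q *m diag_mx (a + b) *m Q^T = Q *m diag_mx a *m Q^T + Q *m diag_mx b *m Q^T.
    by rewrite linearD mulmxDr mulmxDl.
  have := lieD HG la lb; rewrite -e.
  exact.
have LZ t a : L a -> L (t *: a).
  move=> la.
  have e : Q *m diag_mx (t *: a) *m Q^T = t *: (Q *m diag_mx a *m Q^T).
    by rewrite linearZ -scalemxAr -scalemxAl.
  have := lieZ t la; rewrite -e.
  exact.
have [C C0 HC] := bounded_below_truncation LD LZ.
have nC0 : 0 <= n%:R * C by rewrite mulr_ge0.
exists (n%:R * C + 1); first by rewrite ltr_wpDl.
move=> g x Gg; have [A [As lA gA]] := cartan HG Gg.
have [k [a [Gk ok kA]]] := conjQ A As lA.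
have La : L a by rewrite /L /= -kA; exact: lie_conj_orth.
have [b [Lb ba bC]] := HC a La.
pose B := Q *m diag_mx b *m Q^T.
have lB : sym_lie B by split=> //; rewrite !trmx_mul trmxK tr_diag_mx mulmxA.
pose B' := k^T *m B *m k.
have lB' : sym_lie B'.
  rewrite /B' -{2}(trmxK k); apply: sym_lie_conj => //; last exact: orth_tr.
  exact: (sagT HG).
have Bn : frob B' <= n%:R * C.
  rewrite frob_orthr // frob_orthl; last exact: orth_tr.
  rewrite frob_orthr; last exact: orth_tr.
  rewrite frob_orthl //; apply: le_trans (frob_le_sum _) _.
  rewrite -[n in n%:R]card_ord mulr_natl -sumr_const; apply: ler_sum => i _.
  rewrite (bigD1 i) //= big1 => [|j ji]; rewrite mxE; last by rewrite eq_sym (negbTE ji) normr0.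
  by rewrite eqxx addr0 mulr1n.
pose z := Q^T *m (k *m x).
have gx : ip (g *m x) (g *m x) = \sum_i expR (a 0 i) * z i 0 ^+ 2.
  rewrite ip_mull mulmxA gA ipC.
  have -> : mexp A = k^T *m (Q *m diag_mx (map_mx expR a) *m Q^T) *m k.
    have AE : A = k^T *m (Q *m diag_mx a *m Q^T) *m k.
      by rewrite -kA !mulmxA ok mul1mx -mulmxA ok mulmx1.
    rewrite [in LHS]AE mexp_conj; last exact: orthC.
    by rewrite -[_ *m Q^T in LHS]scale1r mexp_spectral // scale1r.
  rewrite -!(mulmxA k^T) ip_mull trmxK -[_ *m k *m x]mulmxA ip_diag_spectral.
  by apply: eq_bigr => i _; rewrite mxE.
have xx : ip x x = \sum_i z i 0 ^+ 2.
  rewrite -(ip_orthl x x ok) -(ip_orthl (k *m x) (k *m x) (orth_tr oQ)) ip_sqr.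
  by apply: eq_bigr => i _; rewrite big_ord1.
have Bx : ip (B' *m x) x = \sum_i b 0 i * z i 0 ^+ 2.
  by rewrite /B' -!(mulmxA k^T) ip_mull trmxK -[_ *m k *m x]mulmxA ip_diag_spectral.
have h : ip x x - ip (g *m x) (g *m x) <= - ip (B' *m x) x.
  rewrite gx xx Bx -sumrB -sumrN; apply: ler_sum => i _.
  (* Either [b_i <= a_i], and [expR a_i >= 1 + a_i] applies, or [b_i <= -1], and [expR a_i >= 0] is
     enough. *)
  suff : 1 - expR (a 0 i) <= - b 0 i.
    by move=> hb; have := ler_wpM2r (sqr_ge0 (z i 0)) hb; lra.
  have := ba i; have := expR_ge1Dx (a 0 i); have := expR_ge0 (a 0 i); rewrite le_max.
  by move=> e0 e1 /orP[|]; lra.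
apply: le_trans h _; rewrite -(momentE x lB').
have := ip_norm_le (moment x) B'; rewrite ler_norml => /andP[h _].
have := ler_wpM2l (frob_ge0 (moment x)) Bn.
have := frob_ge0 (moment x); lra.
Qed.

End MomentMap.

(** * The scalar inequality behind finite length *)

Section RealInequality.
Context {R : realType}.

Definition root4 (a : R) : R := Num.sqrt (Num.sqrt a).

Lemma root4_ge0 a : 0 <= root4 a.
Proof. exact: sqrtr_ge0. Qed.

Lemma root4X a : 0 <= a -> root4 a ^+ 4 = a.
Proof. by move=> a0; rewrite (exprM _ 2 2) !sqr_sqrtr ?sqrtr_ge0. Qed.

Lemma root4_le a b : a <= b -> root4 a <= root4 b.
Proof. by move=> ab; apply: ler_wsqrtr; apply: ler_wsqrtr. Qed.

(* With [D] the excess of the squared norm and [F] the norm of the moment map, [root4 (D * F)]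
   decreases along a step at least proportionally to the displacement. The point is
   [(D - s F^2) (F^2 - s v^2) <= F^2 (sqrt D - s v)^2]. *)
Lemma lyapunov_decrease (D0 D1 F0 F1 s v C : R) :
  0 <= D1 -> 0 <= F0 -> 0 <= F1 -> 0 <= s -> 0 <= v -> 0 <= C ->
  D1 <= D0 - s * F0 ^+ 2 -> F1 ^+ 2 <= F0 ^+ 2 - s * v ^+ 2 -> D0 <= C * F0 ->
  s * v <= 4 * root4 C * (root4 (D0 * F0) - root4 (D1 * F1)).
Proof.
move=> D1_0 F0_0 F1_0 s0 v0 C0 D10 F10 DF.
have sF : 0 <= s * F0 ^+ 2 by rewrite mulr_ge0 ?sqr_ge0.
have sv2 : 0 <= s * v ^+ 2 by rewrite mulr_ge0 ?sqr_ge0.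
have D0_0 : 0 <= D0 by lra.
have sv0 : 0 <= s * v by rewrite mulr_ge0.
pose d0 := Num.sqrt D0; pose d1 := Num.sqrt D1.
have d0_0 : 0 <= d0 by exact: sqrtr_ge0.
have d1_0 : 0 <= d1 by exact: sqrtr_ge0.
have d0E : d0 ^+ 2 = D0 by rewrite sqr_sqrtr.
have d1E : d1 ^+ 2 = D1 by rewrite sqr_sqrtr.
have svd : s * v <= d0.
  rewrite -(@ler_pXn2r _ 2) ?nnegrE // d0E.
  have : s * (s * v ^+ 2) <= s * F0 ^+ 2 by rewrite ler_wpM2l //; have := sqr_ge0 F1; lra.
  by rewrite exprMn expr2 -mulrA; lra.
have dF : d1 * F1 <= F0 * (d0 - s * v).
  rewrite -(@ler_pXn2r _ 2) ?nnegrE ?mulr_ge0 ?subr_ge0 // exprMn d1E.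
  apply: (@le_trans _ _ ((D0 - s * F0 ^+ 2) * (F0 ^+ 2 - s * v ^+ 2))).
    by apply: ler_pM; rewrite ?sqr_ge0.
  rewrite -d0E -subr_ge0.
  have -> : (F0 * (d0 - s * v)) ^+ 2 - (d0 ^+ 2 - s * F0 ^+ 2) * (F0 ^+ 2 - s * v ^+ 2) =
    s * (v * d0 - F0 ^+ 2) ^+ 2 by ring.
  by rewrite mulr_ge0 ?sqr_ge0.
have d10 : d1 <= d0 by apply: ler_wsqrtr; lra.
pose a := root4 (D0 * F0); pose b := root4 (D1 * F1); pose c := root4 C.
have [[a0 b0] c0] := (root4_ge0 (D0 * F0), root4_ge0 (D1 * F1), root4_ge0 C).
have aE : a ^+ 4 = d0 ^+ 2 * F0 by rewrite root4X ?mulr_ge0 // d0E.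
have bE : b ^+ 4 = d1 ^+ 2 * F1 by rewrite root4X ?mulr_ge0 // d1E.
have cE : c ^+ 4 = C by rewrite root4X.
rewrite -/a -/b -/c.
have ab4 : b ^+ 4 <= a ^+ 4 - d0 * F0 * (s * v).
  have : d1 * (d1 * F1) <= d0 * (F0 * (d0 - s * v)) by apply: ler_pM; rewrite ?mulr_ge0.
  by rewrite aE bE !expr2; lra.
have ba : b <= a.
  rewrite -(@ler_pXn2r _ 4) ?nnegrE //.
  have : 0 <= d0 * F0 * (s * v) by rewrite !mulr_ge0.
  lra.
(* Here [D0 <= C * F0] enters: it bounds [d0 ^+ 4] by [C * a ^+ 4]. Multiplying [h1] by [d0] below
   then produces the factor [a ^+ 4] on both sides. *)
have dca : d0 <= c * a.
  rewrite -(@ler_pXn2r _ 4) ?nnegrE ?mulr_ge0 // exprMn cE aE.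
  have : d0 ^+ 2 * D0 <= d0 ^+ 2 * (C * F0) by rewrite ler_wpM2l ?sqr_ge0.
  by rewrite -d0E; lra.
have [a_0|a_0] := eqVneq a 0.
  have d00 : d0 = 0 by apply/eqP; rewrite eq_le d0_0 andbT; move: dca; rewrite a_0 mulr0.
  have : s * v <= 0 by rewrite -d00.
  by move/le_trans; apply; rewrite !mulr_ge0 ?subr_ge0.
have ap : 0 < a by rewrite lt_def a_0.
have h1 : d0 * F0 * (s * v) <= 4 * a ^+ 3 * (a - b).
  have : a ^+ 4 - b ^+ 4 <= 4 * a ^+ 3 * (a - b).
    have -> : a ^+ 4 - b ^+ 4 = (a ^+ 3 + a ^+ 2 * b + a * b ^+ 2 + b ^+ 3) * (a - b) by ring.
    apply: ler_wpM2r; first by rewrite subr_ge0.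
    have e1 : a ^+ 2 * b <= a ^+ 2 * a by rewrite ler_wpM2l ?sqr_ge0.
    have b2 : b ^+ 2 <= a ^+ 2 by rewrite lerXn2r.
    have e2 : a * b ^+ 2 <= a * a ^+ 2 by rewrite ler_wpM2l.
    have e3 : b ^+ 3 <= a ^+ 3 by rewrite lerXn2r.
    have -> : 4 * a ^+ 3 = a ^+ 3 + a ^+ 2 * a + a * a ^+ 2 + a ^+ 3 by ring.
    lra.
  lra.
have h2 : a ^+ 4 * (s * v) <= a ^+ 4 * (4 * c * (a - b)).
  have := ler_wpM2l d0_0 h1.
  have -> : d0 * (d0 * F0 * (s * v)) = a ^+ 4 * (s * v) by rewrite aE; ring.
  move/le_trans; apply.
  have -> : a ^+ 4 * (4 * c * (a - b)) = (c * a) * (4 * a ^+ 3 * (a - b)) by ring.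
  by apply: ler_wpM2r => //; rewrite !mulr_ge0 ?exprn_ge0 ?subr_ge0.
by move: h2; rewrite ler_pM2l ?exprn_gt0.
Qed.

End RealInequality.

(** * Convergence of sequences of finite length *)

Section Limits.
Context {R : realType}.

Lemma frob_cvg_eps {T : Type} {F : set_system T} {FF : Filter F} m n
    (f : T -> 'M[R]_(m, n)) (l : 'M[R]_(m, n)) :
  (forall e, 0 < e -> \forall x \near F, frob (f x - l) < e) -> f x @[x --> F] --> l.
Proof.
move=> fe; apply/cvg_mxP => i j; apply/cvgrPdist_lt => e e0; near=> x.
rewrite distrC; apply: le_lt_trans (_ : frob (f x - l) < e); last by near: x; exact: fe.
by have := entry_le (f x - l) i j; rewrite !mxE.
Unshelve. all: end_near. Qed.

(** Entry by entry, [u + phi] is nonincreasing and bounded below, and [phi] converges too; the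
    distance to the limit follows by telescoping. *)
Lemma cvg_of_decrease m n (u : nat -> 'M[R]_(m, n)) (phi : nat -> R) :
  (forall N, 0 <= phi N) -> (forall N, frob (u N.+1 - u N) <= phi N - phi N.+1) ->
  exists2 l : 'M[R]_(m, n), u N @[N --> \oo] --> l & forall N, frob (l - u N) <= phi N.
Proof.
move=> phi0 uphi.
have phi_dec : {homo phi : a b / (a <= b)%N >-> b <= a}.
  apply/nonincreasing_seqP => N; rewrite -subr_ge0.
  by apply: le_trans (uphi N); exact: frob_ge0.
have phic : cvgn phi.
  apply: nonincreasing_is_cvgn => //; exists 0 => _ [N _ <-]; exact: phi0.
have entryc i j : cvgn (fun N => u N i j).
  have e N : `|u N.+1 i j - u N i j| <= phi N - phi N.+1.
    by apply: le_trans (uphi N); have := entry_le (u N.+1 - u N) i j; rewrite !mxE.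
  have low N : u 0%N i j - phi 0%N <= u N i j - phi N.
    elim: N => [|N IH]; first by [].
    by apply: le_trans IH _; have := e N; rewrite ler_norml => /andP[]; lra.
  have ac : cvgn (fun N => u N i j + phi N).
    apply: nonincreasing_is_cvgn.
      apply/nonincreasing_seqP => N; have := e N; rewrite ler_norml => /andP[]; lra.
    exists (u 0%N i j - phi 0%N) => _ [N _ <-].
    by have := low N; have := phi0 N; lra.
  have -> : (fun N => u N i j) = (fun N => (u N i j + phi N) - phi N).
    by apply/funext => N; rewrite addrK.
  exact: is_cvgB.
pose l : 'M[R]_(m, n) := \matrix_(i, j) limn (fun N => u N i j).
have ul : u N @[N --> \oo] --> l.
  apply/cvg_mxP => i j; rewrite mxE; exact: entryc.
exists l => // N.
apply: (@frob_lim_le _ _ \oo _ _ _ (fun k => u (k + N)%N - u N)).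
  apply: cvgB; last exact: cvg_cst.
  by have := ul; rewrite -(cvg_shiftn N).
near=> k; elim: (k) => [|j IH]; first by rewrite subrr frob0.
suff H i : frob (u (i + N)%N - u N) <= phi N - phi (i + N)%N.
  by apply: le_trans (H _) _; rewrite gerBl.
elim: i => [|i IHi]; first by rewrite !subrr frob0.
have -> : u (i.+1 + N)%N - u N = (u (i + N).+1 - u (i + N)%N) + (u (i + N)%N - u N).
  by rewrite addrA subrK.
apply: le_trans (frobD _ _) _; have := uphi (i + N)%N; rewrite addSn; lra.
Unshelve. all: end_near. Qed.

End Limits.

(** * The moves, their infinite composition and its continuity *)

Section Retraction.
Context {R : realType} {n : nat}.
Variable G : set 'M[R]_n.
Hypothesis HG : selfadjoint_group G.

Local Notation F := (moment HG).
Implicit Types x y : 'cV[R]_n.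

Definition excess x := ip x x - inf [set ip (g *m x) (g *m x) | g in G].

Lemma orbit_norms_lb x : has_lbound [set ip (g *m x) (g *m x) | g in G].
Proof. by exists 0 => _ [g _ <-]; exact: ip_ge0. Qed.

Lemma orbit_norms_inf x : has_inf [set ip (g *m x) (g *m x) | g in G].
Proof.
split; last exact: orbit_norms_lb.
by exists (ip (1%:M *m x) (1%:M *m x)), 1%:M => //; exact: (sag1 HG).
Qed.

Lemma excess_ge0 x : 0 <= excess x.
Proof.
rewrite subr_ge0; apply: ge_inf; first exact: orbit_norms_lb.
by exists 1%:M; [exact: (sag1 HG)|rewrite mul1mx].
Qed.

(** The orbit of [g *m x] lies in that of [x], so the infimum cannot go down and the excess falls at
    least as much as the squared norm. *)
Lemma excess_orbit g x : G g -> excess (g *m x) <= excess x - (ip x x - ip (g *m x) (g *m x)).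
Proof.
move=> Gg; rewrite /excess.
suff : inf [set ip (h *m x) (h *m x) | h in G] <=
    inf [set ip (h *m (g *m x)) (h *m (g *m x)) | h in G] by move=> h; lra.
apply: lb_le_inf; first by have [] := orbit_norms_inf (g *m x).
move=> _ [h Gh <-]; apply: ge_inf; first exact: orbit_norms_lb.
by exists (h *m g); [exact: (sagM HG)|rewrite mulmxA].
Qed.

Lemma excess_le : exists2 C, 0 < C & forall x, excess x <= C * frob (F x).
Proof.
have [C C0 HC] := key_inequality HG; exists C => // x.
rewrite lerBlDr addrC -lerBlDr; apply: lb_le_inf.
  by have [] := orbit_norms_inf x.
by move=> _ [g Gg <-]; have := HC g x Gg; lra.
Qed.

(** Since [frob (F x) <= ip x x], this size meets the smallness condition of the step estimates. It
    depends only on the norm, which keeps the moves [K]-equivariant; the added 1 avoids a zero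
    denominator at the origin. *)
Definition tau x : R := (16 * (1 + ip x x))^-1.

Lemma tau_den x : 0 < 16 * (1 + ip x x).
Proof. by rewrite mulr_gt0 // ltr_pwDl // ip_ge0. Qed.

Lemma tau_gt0 x : 0 < tau x.
Proof. by rewrite invr_gt0 tau_den. Qed.

Lemma tau_norm x : 16 * (tau x * ip x x) <= 1.
Proof.
by rewrite mulrCA /tau mulrC ler_pdivrMr ?tau_den // mul1r ler_pM2l // lerDr.
Qed.

Definition step (c : R) x := mexp (- (c * tau x) *: F x) *m x.

Lemma step_group c x : G (mexp (- (c * tau x) *: F x)).
Proof. by have [lF _] := moment_lie HG x; exact: lF. Qed.

Section StepBounds.
Variables (c : R) (x : 'cV[R]_n).
Hypothesis c01 : 0 <= c <= 1.

Let s := c * tau x.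
Let v := frob (F x *m x).

Let s0 : 0 <= s.
Proof. by have /andP[c0 _] := c01; rewrite mulr_ge0 // ltW // tau_gt0. Qed.

Let sx : 16 * (s * ip x x) <= 1.
Proof.
have /andP[c0 c1] := c01; apply: le_trans (tau_norm x).
by rewrite ler_pM2l // ler_wpM2r ?ip_ge0 // /s ler_piMl // ltW // tau_gt0.
Qed.

Let sF : 16 * (s * frob (F x)) <= 1.
Proof.
apply: le_trans sx; rewrite ler_pM2l // ler_wpM2l //.
by rewrite -frob_sqr moment_le.
Qed.

Let Fs : (F x)^T = F x.
Proof. by have [_] := moment_lie HG x. Qed.

Let Fx : ip (F x *m x) x = frob (F x) ^+ 2.
Proof. by rewrite -(momentE HG x (moment_lie HG x)) frob_sqr. Qed.

Let v2 : v ^+ 2 <= frob (F x) ^+ 2 * ip x x.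
Proof.
by rewrite -frob_sqr -exprMn lerXn2r ?nnegrE ?mulr_ge0 ?frob_ge0 // frobM.
Qed.

Lemma step_norm_decrease : s * frob (F x) ^+ 2 <= ip x x - ip (step c x) (step c x).
Proof.
apply: le_trans (step_norm x Fs s0 sF); rewrite Fx -frob_sqr -/v.
have : s * v ^+ 2 <= s * (frob (F x) ^+ 2 * ip x x) by rewrite ler_wpM2l.
have := ler_wpM2l (mulr_ge0 s0 (sqr_ge0 (frob (F x)))) sx.
move=> h1 h2; have := ler_wpM2l s0 h2.
have := mulr_ge0 s0 (sqr_ge0 (frob (F x))).
lra.
Qed.

Lemma step_norm_le : frob (step c x) <= frob x.
Proof.
rewrite -(@ler_pXn2r _ 2) ?nnegrE ?frob_ge0 // !frob_sqr -subr_ge0.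
by apply: le_trans step_norm_decrease; rewrite mulr_ge0 ?sqr_ge0.
Qed.

Lemma step_displacement : frob (step c x - x) <= 2 * s * v.
Proof. by have := step_dist x Fs s0 sF; exact. Qed.

(** Expand around [F x]: the linear term is twice the quadratic form of the fixed matrix [F x] at
    the new point, lowered by [3 / 2 * s * v ^+ 2] in [step_form]. The quadratic term [frob D ^+ 2]
    costs at most [s * v ^+ 2], because [16 * (s * ip x x) <= 1]. *)
Lemma step_moment_decrease : frob (F (step c x)) ^+ 2 <= frob (F x) ^+ 2 - s * v ^+ 2.
Proof.
set y := step c x; pose D := F y - F x.
have e : frob (F y) ^+ 2 = 2 * ip (F x *m y) y - frob (F x) ^+ 2 + frob D ^+ 2.
  rewrite -(momentE HG y (moment_lie HG x)) !frob_sqr /D !ip_lin (ipC (F x) (F y)); ring.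
have f : ip (F x *m y) y <= frob (F x) ^+ 2 - 3 / 2 * s * v ^+ 2.
  by have := step_form x Fs s0 sF; rewrite Fx -frob_sqr.
have v0 : 0 <= v by exact: frob_ge0.
have D1 : frob D <= 4 * s * v * frob x.
  apply: le_trans (moment_lip HG _ _) _.
  have -> : 4 * s * v * frob x = (2 * s * v) * (frob x + frob x) by ring.
  apply: ler_pM; rewrite ?frob_ge0 ?addr_ge0 ?frob_ge0 ?step_displacement //.
  by rewrite addrC lerD2l step_norm_le.
have D2 : frob D ^+ 2 <= s * v ^+ 2.
  apply: (@le_trans _ _ ((4 * s * v * frob x) ^+ 2)).
    have b0 := le_trans (frob_ge0 _) D1.
    by rewrite ler_pXn2r ?nnegrE ?frob_ge0.
  have -> : (4 * s * v * frob x) ^+ 2 = s * v ^+ 2 * (16 * (s * frob x ^+ 2)) by ring.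
  by rewrite frob_sqr ler_piMr // mulr_ge0 ?sqr_ge0.
rewrite e; have := mulr_ge0 s0 (sqr_ge0 v); lra.
Qed.

End StepBounds.


(** The factor 8 is the 4 of [lyapunov_decrease] times the 2 of [step_displacement]. One [phi]
    serves all fractions [c], so it controls incomplete moves as well. *)
Lemma step_lyapunov : exists phi : 'cV[R]_n -> R, exists2 M, 0 <= M &
  (forall x, 0 <= phi x <= M * Num.sqrt (frob (F x))) /\
  forall c x, 0 <= c <= 1 -> frob (step c x - x) <= phi x - phi (step c x).
Proof.
have [C C0 HC] := excess_le; have c4 := root4_ge0 C.
exists (fun x => 8 * root4 C * root4 (excess x * frob (F x))).
exists (8 * root4 C * root4 C); first by rewrite !mulr_ge0.
split=> [x|c x c01].
  rewrite mulr_ge0 ?mulr_ge0 ?root4_ge0 //=.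
  rewrite -[leRHS]mulrA ler_wpM2l ?mulr_ge0 //.
  have -> : root4 C * Num.sqrt (frob (F x)) = root4 (C * frob (F x) ^+ 2).
    rewrite /root4 sqrtrM ?ltW // sqrtr_sqr ger0_norm ?frob_ge0 // sqrtrM //.
  by apply: root4_le; rewrite expr2 mulrA ler_wpM2r ?frob_ge0.
have s0 : 0 <= c * tau x by have /andP[h _] := c01; rewrite mulr_ge0 // ltW // tau_gt0.
have ex : excess (step c x) <= excess x - c * tau x * frob (F x) ^+ 2.
  apply: le_trans (excess_orbit _ (step_group c x)) _.
  by have := step_norm_decrease x c01; rewrite -/(step c x); lra.
have := lyapunov_decrease (excess_ge0 _) (frob_ge0 _) (frob_ge0 _) s0 (frob_ge0 (F x *m x))
  (ltW C0) ex (step_moment_decrease x c01) (HC x).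
by have := step_displacement x c01; lra.
Qed.

Lemma step0 x : step 0 x = x.
Proof. by rewrite /step mul0r oppr0 scale0r mexp0 mul1mx. Qed.

Lemma step_critical c x : F x = 0 -> step c x = x.
Proof. by move=> Fx0; rewrite /step Fx0 scaler0 mexp0 mul1mx. Qed.

Lemma step_equivariant c k x : G k -> orth k -> step c (k *m x) = k *m step c x.
Proof.
move=> Gk ok; rewrite /step moment_equivariant // /tau ip_orthl //.
rewrite scalemxAl scalemxAr mexp_conj //.
by rewrite -!mulmxA orth_mulK.
Qed.

Lemma cvg_moment {T : Type} {FT : set_system T} {FF : Filter FT} (x_ : T -> 'cV[R]_n) x :
  x_ y @[y --> FT] --> x -> F (x_ y) @[y --> FT] --> F x.
Proof.
move=> xx.
have h1 : \forall y \near FT, frob (F (x_ y) - F x) <= frob (x_ y - x) * (frob (x_ y) + frob x).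
  by near=> y; exact: moment_lip.
have h2 : frob (x_ y - x) * (frob (x_ y) + frob x) @[y --> FT] --> (0 : R).
  rewrite -(mul0r (frob x + frob x)); apply: cvgM; first exact: cvg_frob0.
  by apply: cvgD; [exact: cvg_frob|exact: cvg_cst].
have := frob_cvg h1 h2; exact.
Unshelve. all: end_near. Qed.

Lemma cvg_step {T : Type} {FT : set_system T} {FF : Filter FT} (c_ : T -> R) (x_ : T -> 'cV[R]_n)
    (c : R) x :
  c_ y @[y --> FT] --> c -> x_ y @[y --> FT] --> x -> step (c_ y) (x_ y) @[y --> FT] --> step c x.
Proof.
move=> cc xx; apply: cvg_mulmx => //; apply: cvg_mexp; apply: cvgZ; last exact: cvg_moment.
apply: cvgN; apply: cvgM => //; apply: cvgV; first by rewrite gt_eqF // tau_den.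
apply: cvgM; first exact: cvg_cst.
by apply: cvgD; [exact: cvg_cst|exact: cvg_ip].
Qed.

Fixpoint steps (c : nat -> R) N x := if N is N'.+1 then step (c N') (steps c N' x) else x.

(* At [t = 1] every step is complete, while at [t < 1] all but finitely many are trivial. *)
Definition schedule (t : R) (N : nat) : R := Num.max 0 (Num.min 1 (1 - N.+1%:R * (1 - t))).

Lemma schedule01 t N : 0 <= schedule t N <= 1.
Proof. by rewrite /schedule le_max lexx /= ge_max ler01 ge_min lexx. Qed.

Lemma schedule_at1 N : schedule 1 N = 1.
Proof. by rewrite /schedule subrr mulr0 subr0 minxx; apply/max_idPr. Qed.

Lemma schedule_eq0 t N : 1 <= N.+1%:R * (1 - t) -> schedule t N = 0.
Proof.
move=> h; rewrite /schedule; apply/max_idPl; rewrite ge_min; apply/orP; right; lra.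
Qed.

Lemma cvg_schedule {T : Type} {FT : set_system T} {FF : Filter FT} (t_ : T -> R) (t : R) N :
  t_ y @[y --> FT] --> t -> schedule (t_ y) N @[y --> FT] --> schedule t N.
Proof.
move=> tt; have h : 1 - N.+1%:R * (1 - t_ y) @[y --> FT] --> 1 - N.+1%:R * (1 - t).
  apply: cvgB; first exact: cvg_cst.
  by apply: cvgM; [exact: cvg_cst|apply: cvgB => //; exact: cvg_cst].
have gc : continuous (fun u : R => Num.max 0 (Num.min 1 u)).
  move=> u; apply: (@continuous_max _ _ (fun=> 0) (fun u : R => Num.min 1 u)).
    exact: cst_continuous.
  apply: (@continuous_min _ _ (fun=> 1) id); first exact: cst_continuous.
  exact: cvg_id.
have := @continuous_cvg _ _ _ FT _ _ _ _ (gc _) h; exact.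
Qed.

Definition retract t x : 'cV[R]_n := lim (steps (schedule t) N x @[N --> \oo]).

(** [M] depends on neither [t] nor [x]: the rest of any trajectory is controlled by the moment map
    at its current point, as [cvg_retract] needs at time 1. *)
Lemma retract_bounds : exists2 M, 0 <= M & forall t x,
  steps (schedule t) N x @[N --> \oo] --> retract t x /\
  forall N, frob (retract t x - steps (schedule t) N x) <=
    M * Num.sqrt (frob (F (steps (schedule t) N x))).
Proof.
have [phi [M M0 [phiM phi_dec]]] := step_lyapunov; exists M => // t x.
have [N|N|l ul lb] := @cvg_of_decrease _ _ _ (steps (schedule t) ^~ x)
    (fun N => phi (steps (schedule t) N x)).
- by have /andP[] := phiM (steps (schedule t) N x).
- exact: phi_dec (schedule01 t N).
have rl : retract t x = l.
  by apply: cvg_lim => //; exact: norm_hausdorff.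
rewrite rl; split=> // N; apply: le_trans (lb N) _.
by have /andP[] := phiM (steps (schedule t) N x).
Qed.

Lemma retract_cvg t x : steps (schedule t) N x @[N --> \oo] --> retract t x.
Proof. by have [M _ h] := retract_bounds; have [] := h t x. Qed.

Lemma retractE t x (l : 'cV[R]_n) :
  steps (schedule t) N x @[N --> \oo] --> l -> retract t x = l.
Proof. by move=> h; have := cvg_mx_unique (@retract_cvg t x) h; exact. Qed.

Lemma retract_stationary t x N0 : (forall N, (N0 <= N)%N -> schedule t N = 0) ->
  retract t x = steps (schedule t) N0 x.
Proof.
move=> t0; apply: retractE; apply: cvg_near_cst; near=> N.
have N0N : (N0 <= N)%N by near: N; exact: nbhs_infty_ge.
rewrite -(subnK N0N); elim: (N - N0)%N => [|k IH]; first by rewrite add0n.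
by rewrite addSn /= t0 ?leq_addl // step0.
Unshelve. all: end_near. Qed.

Lemma retract0 x : retract 0 x = x.
Proof.
rewrite (@retract_stationary 0 x 0) // => N _; apply: schedule_eq0.
by rewrite subr0 mulr1 ler1n.
Qed.

Lemma retract_critical t x : F x = 0 -> retract t x = x.
Proof.
move=> Fx0; apply: retractE; rewrite (_ : (fun N => _) = fun=> x); first exact: cvg_cst.
by apply/funext; elim=> // N /= ->; exact: step_critical.
Qed.

Lemma retract_equivariant t k x : G k -> orth k -> retract t (k *m x) = k *m retract t x.
Proof.
move=> Gk ok; apply: retractE.
rewrite (_ : (fun N => _) = fun N => k *m steps (schedule t) N x).
  by apply: cvg_mulmx; [exact: cvg_cst|exact: retract_cvg].
by apply/funext; elim=> // N /= ->; exact: step_equivariant.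
Qed.

Lemma steps_orbit t x N : exists2 g, G g & steps (schedule t) N x = g *m x.
Proof.
elim: N => [|N [g Gg e]]; first by exists 1%:M; [exact: (sag1 HG)|rewrite mul1mx].
exists (mexp (- (schedule t N * tau (g *m x)) *: F (g *m x)) *m g); last by rewrite /= e /step mulmxA.
by apply: (sagM HG) => //; exact: step_group.
Qed.

(** Norms decrease along the sequence, so [tau] stays at least [tau x]. The squared norms converge,
    so their decrements tend to 0 and force the moment map to 0. *)
Lemma moment_steps_cvg0 x : F (steps (schedule 1) N x) @[N --> \oo] --> (0 : 'M[R]_n).
Proof.
pose u N := steps (schedule 1) N x; pose a N := ip (u N) (u N).
have uS N : u N.+1 = step 1 (u N) by rewrite /u /= schedule_at1.
have c01 : 0 <= (1 : R) <= 1 by rewrite ler01 lexx.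
have aS N : tau (u N) * frob (F (u N)) ^+ 2 <= a N - a N.+1.
  by have := step_norm_decrease (u N) c01; rewrite mul1r /a uS.
have a_dec : {homo a : i j / (i <= j)%N >-> j <= i}.
  apply/nonincreasing_seqP => N; rewrite -subr_ge0; apply: le_trans (aS N).
  by rewrite mulr_ge0 ?sqr_ge0 // ltW // tau_gt0.
have tau_ge N : tau x <= tau (u N).
  rewrite lef_pV2 ?posrE ?tau_den // ler_pM2l // lerD2l; exact: (a_dec 0%N N).
have ac : cvgn a by apply: nonincreasing_is_cvgn => //; exists 0 => _ [N _ <-]; exact: ip_ge0.
have d0 : a N - a N.+1 @[N --> \oo] --> (0 : R).
  rewrite -(subrr (limn a)); apply: cvgB => //.
  by have := ac; rewrite -(cvg_shiftS a).
have f0 : (tau x)^-1 * (a N - a N.+1) @[N --> \oo] --> (0 : R).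
  by rewrite -(mulr0 (tau x)^-1); apply: cvgM => //; exact: cvg_cst.
apply: (frob_cvg (u := fun N => Num.sqrt ((tau x)^-1 * (a N - a N.+1)))).
  near=> N; rewrite subr0 -[leLHS]ger0_norm ?frob_ge0 // -sqrtr_sqr.
  apply: ler_wsqrtr; rewrite ler_pdivlMl ?tau_gt0 //; apply: le_trans (aS N).
  by rewrite ler_wpM2r ?sqr_ge0.
have := @continuous_cvg _ _ _ \oo _ _ Num.sqrt 0 (@sqrt_continuous R _) f0.
rewrite sqrtr0; exact.
Unshelve. all: end_near. Qed.

Lemma retract1_critical x : F (retract 1 x) = 0.
Proof.
have h : F (steps (schedule 1) N x) @[N --> \oo] --> F (retract 1 x).
  by apply: cvg_moment; exact: retract_cvg.
by have := cvg_mx_unique h (@moment_steps_cvg0 x); exact.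
Qed.

Lemma cvg_steps {T : Type} {FT : set_system T} {FF : Filter FT} (t_ : T -> R)
    (x_ : T -> 'cV[R]_n) (t : R) x N :
  t_ y @[y --> FT] --> t -> x_ y @[y --> FT] --> x ->
  steps (schedule (t_ y)) N (x_ y) @[y --> FT] --> steps (schedule t) N x.
Proof.
by move=> tt xx; elim: N => //= N IH; apply: cvg_step => //; exact: cvg_schedule.
Qed.

(** Before time 1 the retraction is locally a fixed finite composition of continuous moves. At time
    1, [N] is chosen so that the tail bound at [(1, x)] is below [e / 3]; this bound varies
    continuously with time and point, as do the first [N] moves, so both persist nearby. *)
Lemma cvg_retract {T : Type} {FT : set_system T} {FF : Filter FT} (t_ : T -> R)
    (x_ : T -> 'cV[R]_n) (t : R) x : t <= 1 ->
  t_ y @[y --> FT] --> t -> x_ y @[y --> FT] --> x ->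
  retract (t_ y) (x_ y) @[y --> FT] --> retract t x.
Proof.
rewrite le_eqVlt => /predU1P[->|t1] tt xx; last first.
  (* From [N0] on, the moves are trivial at every time up to the midpoint [(1 + t) / 2], hence on a
     neighbourhood of [t]. *)
  pose N0 := Num.truncn (2 / (1 - t)).
  have N0P N s : (N0 <= N)%N -> s <= (1 + t) / 2 -> schedule s N = 0.
    move=> N0N st; apply: schedule_eq0.
    have h : 2 / (1 - t) <= N.+1%:R.
      apply: ltW; apply: lt_le_trans (truncnS_gt _) _.
      by rewrite ler_nat ltnS.
    rewrite ler_pdivrMr ?subr_gt0 // in h.
    have : N.+1%:R * ((1 - t) / 2) <= N.+1%:R * (1 - s) by rewrite ler_wpM2l //; lra.
    lra.
  rewrite (@retract_stationary t x N0); last by move=> N hN; apply: N0P => //; lra.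
  have h : steps (schedule (t_ y)) N0 (x_ y) @[y --> FT] --> steps (schedule t) N0 x.
    exact: cvg_steps.
  apply: (cvg_trans _ h); apply: near_eq_cvg.
  near=> y; apply/esym/retract_stationary => N hN; apply: N0P => //; apply: ltW.
  near: y; apply: (cvgr_lt t) => //; lra.
have [M M0 HM] := retract_bounds.
apply: frob_cvg_eps => e e0.
pose b N := M * Num.sqrt (frob (F (steps (schedule 1) N x))).
have b0 : b N @[N --> \oo] --> (0 : R).
  rewrite -(mulr0 M); apply: cvgM; first exact: cvg_cst.
  have f0 : frob (F (steps (schedule 1) N x)) @[N --> \oo] --> (0 : R).
    by rewrite -(@frob0 R n n); apply: cvg_frob; exact: moment_steps_cvg0.
  have := @continuous_cvg _ _ _ \oo _ _ Num.sqrt 0 (@sqrt_continuous R _) f0.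
  rewrite sqrtr0; exact.
have e3 : 0 < e / 3 by rewrite divr_gt0.
have [N bN] : exists N, b N < e / 3.
  have : \forall N \near \oo, b N < e / 3 by apply: (cvgr_lt 0).
  by move=> /filter_ex[N hN]; exists N.
have hs : steps (schedule (t_ y)) N (x_ y) @[y --> FT] --> steps (schedule 1) N x.
  exact: cvg_steps.
have hb : M * Num.sqrt (frob (F (steps (schedule (t_ y)) N (x_ y)))) @[y --> FT] --> b N.
  apply: cvgM; first exact: cvg_cst.
  have hm : F (steps (schedule (t_ y)) N (x_ y)) @[y --> FT] --> F (steps (schedule 1) N x).
    exact: cvg_moment.
  have hf : frob (F (steps (schedule (t_ y)) N (x_ y))) @[y --> FT] -->
      frob (F (steps (schedule 1) N x)) by exact: cvg_frob.
  by have := @continuous_cvg _ _ _ FT _ _ Num.sqrt _ (@sqrt_continuous R _) hf; exact.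
near=> y.
have h1 : M * Num.sqrt (frob (F (steps (schedule (t_ y)) N (x_ y)))) < e / 3.
  by near: y; apply: (cvgr_lt (b N)).
have h2 : frob (steps (schedule (t_ y)) N (x_ y) - steps (schedule 1) N x) < e / 3.
  near: y; apply: (cvgr_lt 0) => //; exact: cvg_frob0.
have h3 := (HM (t_ y) (x_ y)).2 N.
have h4 := (HM 1 x).2 N.
rewrite frobBC in h4.
have -> : retract (t_ y) (x_ y) - retract 1 x =
    (retract (t_ y) (x_ y) - steps (schedule (t_ y)) N (x_ y)) +
    (steps (schedule (t_ y)) N (x_ y) - steps (schedule 1) N x) +
    (steps (schedule 1) N x - retract 1 x) by rewrite !addrA !subrK.
apply: le_lt_trans (frobD _ _) _.
have := frobD (retract (t_ y) (x_ y) - steps (schedule (t_ y)) N (x_ y))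
  (steps (schedule (t_ y)) N (x_ y) - steps (schedule 1) N x).
rewrite -/(b N) in h4; lra.
Unshelve. all: end_near. Qed.

Lemma retract_uniform t x : t <= 1 -> forall e, 0 < e -> exists2 d, 0 < d &
  forall t' x', `|t - t'| < d -> frob (x - x') < d -> frob (retract t x - retract t' x') < e.
Proof.
move=> t1 e e0; have h : retract p.1 p.2 @[p --> (t, x)] --> retract t x.
  by apply: cvg_retract => //; [exact: cvg_fst|exact: cvg_snd].
have : \forall p \near (t, x), frob (retract p.1 p.2 - retract t x) < e.
  have h0 : frob (retract p.1 p.2 - retract t x) @[p --> (t, x)] --> (0 : R).
    exact: cvg_frob0.
  exact: (cvgr_lt 0 h0).
move=> /nbhs_ballP[d /= d0 hd]; exists d => // t' x' tt' xx'.
rewrite frobBC; apply: (hd (t', x')); split => //=.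
split=> // i j; apply: le_lt_trans xx'.
by have := entry_le (x - x') i j; rewrite !mxE.
Qed.

(** The iterates stay in the orbit of [x], but the limit may leave it; closedness of [X] covers the
    limit. *)
Lemma retract_invariant (X : set 'cV[R]_n) :
  (forall x, (forall e, 0 < e -> exists2 y, X y & frob (x - y) < e) -> X x) ->
  (forall g x, G g -> X x -> X (g *m x)) ->
  forall t x, X x -> X (retract t x).
Proof.
move=> Xc XG t x Xx; apply: Xc => e e0.
have : \forall N \near \oo, frob (steps (schedule t) N x - retract t x) < e.
  by apply: (cvgr_lt 0) => //; apply: cvg_frob0; exact: retract_cvg.
move=> /filter_ex[N hN]; exists (steps (schedule t) N x); last by rewrite frobBC.
by have [g Gg ->] := steps_orbit t x N; exact: XG.
Qed.

End Retraction.

(** * Translation between the matrices of the statement and library matrices *)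

Section Translation.
Context {n : nat}.
Local Notation R := Rdefinitions.R.

Definition to_mx (A : mat n) : 'M[R]_n := \matrix_(i, j) A i j.
Definition of_mx (M : 'M[R]_n) : mat n := fun i j => M i j.
Definition to_cv (v : vec n) : 'cV[R]_n := \col_i v i.
Definition of_cv (v : 'cV[R]_n) : vec n := fun i => v i 0.

Lemma to_mxK A : of_mx (to_mx A) = A.
Proof. by apply/funext => i; apply/funext => j; rewrite /of_mx mxE. Qed.

Lemma of_mxK M : to_mx (of_mx M) = M.
Proof. by apply/matrixP => i j; rewrite mxE. Qed.

Lemma to_cvK v : of_cv (to_cv v) = v.
Proof. by apply/funext => i; rewrite /of_cv mxE. Qed.

Lemma of_cvK v : to_cv (of_cv v) = v.
Proof. by apply/colP => i; rewrite mxE. Qed.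

Lemma rsumE (f : 'I_n -> R) : rsum f = \sum_i f i.
Proof. by []. Qed.

Lemma to_mx_mul A B : to_mx (mmul A B) = to_mx A *m to_mx B.
Proof.
apply/matrixP => i j; rewrite !mxE /mmul rsumE.
by apply: eq_bigr => k _; rewrite !mxE.
Qed.

Lemma to_mx_id : to_mx mid = 1%:M.
Proof. by apply/matrixP => i j; rewrite !mxE /mid; case: eqP. Qed.

Lemma to_mx_tr A : to_mx (mtr A) = (to_mx A)^T.
Proof. by apply/matrixP => i j; rewrite !mxE. Qed.

Lemma to_mx_scale t A : to_mx (mscale t A) = t *: to_mx A.
Proof. by apply/matrixP => i j; rewrite !mxE. Qed.

Lemma to_cv_mul A v : to_cv (mvec A v) = to_mx A *m to_cv v.
Proof.
apply/colP => i; rewrite !mxE /mvec rsumE.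
by apply: eq_bigr => k _; rewrite !mxE.
Qed.

Lemma dotE u v : dot u v = ip (to_cv u) (to_cv v).
Proof. by rewrite ipE /dot rsumE; apply: eq_bigr => i _; rewrite big_ord1 !mxE. Qed.

Lemma edistE u v : edist u v = frob (to_cv u - to_cv v).
Proof.
rewrite /edist RsqrtE /frob ipE rsumE; congr (Num.sqrt _).
by apply: eq_bigr => i _; rewrite big_ord1 !mxE.
Qed.

Lemma to_mx_pow A k : to_mx (mpow A k) = to_mx A ^+ k.
Proof.
by elim: k => [|k IH]; rewrite ?expr0 -?idmxE ?to_mx_id //= to_mx_mul IH exprS.
Qed.

(** [sum_f_R0] includes its upper index and [exps] does not, hence [N.+1]. *)
Lemma partial_sumE A N i j :
  sum_f_R0 (fun k => Rdiv (mpow A k i j) (INR (Factorial.fact k))) N = exps (to_mx A) N.+1 i j.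
Proof.
rewrite sum_f_R0E expsE; apply: eq_bigr => k _.
by rewrite -to_mx_pow mxE RdivE INRE factE mulrC.
Qed.

Lemma is_mexpP A E : is_mexp A E <-> mexp (to_mx A) = to_mx E.
Proof.
rewrite mexp_seriesP; split=> h i j e.
  (* Starting at [N.+1] excludes the empty sum, which is no partial sum in the sense of
     [sum_f_R0]. *)
  move=> /RltP e0; have [N hN] := h i j e e0; exists N.+1 => -[//|k].
  by rewrite ltnS => /ssrnat.leP/hN; rewrite partial_sumE RdistE mxE => /RltP.
move=> /RltP e0; have [N hN] := h i j e e0; exists N => k /ssrnat.leP Nk.
by rewrite partial_sumE RdistE; apply/RltP; have := hN k.+1 (leqW Nk); rewrite mxE.
Qed.

Lemma invertibleP A : invertible A <-> to_mx A \in unitmx.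
Proof.
split=> [[B [AB _]]|Au].
  have : to_mx A *m to_mx B = 1%:M by rewrite -to_mx_mul AB to_mx_id.
  by case/mulmx1_unit.
exists (of_mx (invmx (to_mx A))).
split; apply: (can_inj to_mxK); rewrite to_mx_mul of_mxK to_mx_id.
  exact: mulmxV.
exact: mulVmx.
Qed.

Lemma peval_polyfun (p : mpoly n) : polyfun (fun M => peval p (of_mx M)).
Proof.
elim: p => [i j|c|p IHp q IHq|p IHp q IHq] /=.
- exact: polyfun_entry.
- exact: polyfun_const.
- exact: polyfun_add.
- exact: polyfun_mul.
Qed.

Lemma orthogonalP A : orthogonal A <-> orth (to_mx A).
Proof.
rewrite /orthogonal /orth -to_mx_tr -to_mx_mul -to_mx_id.
by split=> [->//|/(can_inj to_mxK)].
Qed.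

Definition group_mx (G : mat n -> Prop) : set 'M[R]_n := [set M | G (of_mx M)].

Lemma group_mxE G A : group_mx G (to_mx A) <-> G A.
Proof. by rewrite /group_mx /= to_mxK. Qed.

Lemma group_mx_selfadjoint G : real_algebraic_subgroup G -> transpose_invariant G ->
  selfadjoint_group (group_mx G).
Proof.
move=> [[S GS] [G1 [GM _]]] GT; split.
- exists [set f | exists2 p, S p & f = fun M => peval p (of_mx M)].
    by move=> _ [p _ ->]; exact: peval_polyfun.
  apply/seteqP; split=> M /=; rewrite /group_mx /=.
    move=> /GS[/invertibleP + MS]; rewrite of_mxK => Mu; split=> // _ [p Sp ->].
    exact: MS.
  move=> [Mu MS]; apply/GS; split; first by apply/invertibleP; rewrite of_mxK.
  by move=> p Sp; apply: (MS (fun M => peval p (of_mx M))); exists p.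
- by rewrite -to_mx_id; apply/group_mxE.
- move=> g h Gg Gh; rewrite -(of_mxK g) -(of_mxK h) -to_mx_mul; apply/group_mxE.
  exact: GM.
- move=> g Gg; rewrite -(of_mxK g) -to_mx_tr; apply/group_mxE; exact: GT.
Qed.

Lemma lie_algP G A : lie_alg G A <-> lie (group_mx G) (to_mx A).
Proof.
split=> h t.
  have [E [/is_mexpP hE GE]] := h t.
  by rewrite -to_mx_scale hE; apply/group_mxE.
exists (of_mx (mexp (t *: to_mx A))); split; last exact: (h t).
by apply/is_mexpP; rewrite of_mxK to_mx_scale.
Qed.

Lemma criticalP G (HG : selfadjoint_group (group_mx G)) v :
  critical G v <-> moment HG (to_cv v) = 0.
Proof.
rewrite moment_eq0P; split=> h A.
  move=> lA; have := h (of_mx A); rewrite dotE to_cv_mul of_mxK; apply.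
  by apply/lie_algP; rewrite of_mxK.
by move=> /lie_algP lA; rewrite dotE to_cv_mul; exact: h.
Qed.

End Translation.

Theorem theorem13 (n : nat) (G : mat n -> Prop)
  (HG : real_algebraic_subgroup G) (HGt : transpose_invariant G)
  (X : vec n -> Prop) (HXc : closed_subset X) (HXG : G_invariant G X) :
  exists U : R -> vec n -> vec n,
    strong_deformation_retraction X (fun x => X x /\ critical G x) U /\
    K_equivariant G X U.
Proof.
have HGm := group_mx_selfadjoint HG HGt.
pose U t x := of_cv (retract HGm t (to_cv x)).
have XU t x : X x -> X (U t x).
  pose Xm : set 'cV[R]_n := [set v | X (of_cv v)].
  move=> Xx; have := @retract_invariant _ _ _ HGm Xm _ _ t (to_cv x); apply.
  - move=> v hv; apply: HXc => e /RltP e0; have [y Xy vy] := hv e e0.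
    by exists (of_cv y); split=> //; rewrite edistE !of_cvK; apply/RltP.
  - move=> g v Gg Xv; rewrite /Xm /= -(of_cvK v) -(of_mxK g) -to_cv_mul to_cvK.
    exact: HXG.
  - by rewrite /Xm /= to_cvK.
have U1 x : critical G (U 1 x).
  by apply/(criticalP HGm); rewrite of_cvK; exact: retract1_critical.
have Ucrit t x : critical G x -> U t x = x.
  by move=> /(criticalP HGm) cx; rewrite /U retract_critical // to_cvK.
exists U; split; last first.
  move=> t k x _ [Gk /orthogonalP ok] _.
  rewrite /U to_cv_mul retract_equivariant //; last exact/group_mxE.
  by rewrite -[in RHS](to_cvK (mvec _ _)) to_cv_mul of_cvK.
split; [|split; [|split; [|split; [|split]]]].
- move=> t x [_ /RleP t1] _ e /RltP e0.
  have [d d0 hd] := retract_uniform HGm (to_cv x) t1 e0.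
  exists d; split; first exact/RltP.
  move=> t' x' _ _ /RltP tt' /RltP xx'; apply/RltP; rewrite edistE !of_cvK.
  by apply: hd; [rewrite -RabsE|rewrite -edistE].
- by move=> t x _; exact: XU.
- by move=> x _; rewrite /U retract0 to_cvK.
- by move=> t w _ [_ cw]; exact: Ucrit.
- by move=> x Xx; split; [exact: XU|exact: U1].
(* Critical points are fixed at all times, so each is its own preimage. *)
- by move=> w [Xw cw]; exists w; split=> //; exact: Ucrit.
Qed.
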